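(* A graph $G$ is a polar-cat if and only if $G$ is primitive and $G$ can be explained by a labeled level-1 network.
   Context: All graphs finite, simple, undirected; $G-v$, complement, join, cograph (no induced $P_4$) as usual. Module of $G=(V,E)$: $M\subseteq V$ with $N_G(x)\setminus M=N_G(y)\setminus M$ for all $x,y\in M$; $G$ is primitive if $|V|\ge4$ and its only modules are $V$ and singletons (and $\emptyset$). Network on finite $X$: a DAG $N=(V,E)$ with either $V=X=\{x\}$, or (N1) unique root of indegree 0, outdegree $\ge2$; (N2) $x\in X$ iff outdegree 0, indegree 1; (N3) every other non-root vertex has indegree 1 and outdegree $\ge2$, or indegree 2 (hybrid-vertex) and outdegree $\ge1$. Level-1: every biconnected component of the underlying undirected graph contains at most one hybrid-vertex (then lowest common ancestors $\mathrm{lca}_N(x,y)$ of leaves are unique). A labeled network $(N,t)$ has $t:V\to\{0,1,\odot\}$, $t(v)=\odot$ iff $v\in X$; it explains $G$ if $G$ is isomorphic to the graph on $X$ where $x\ne y$ are adjacent iff $t(\mathrm{lca}_N(x,y))=1$. Polar-cats: $G$ is a $(v,G_1,G_2)$-pseudo-cograph if $G_1,G_2$ are induced subgraphs, $v\in V(G)$, with $V(G)=V(G_1)\cup V(G_2)$, $V(G_1)\cap V(G_2)=\{v\}$, $|V(G_1)|,|V(G_2)|>1$, $G_1,G_2$ cographs, and $G-v$ the join or disjoint union of $G_1-v$ and $G_2-v$. A caterpillar is a rooted tree whose inner vertices each have two children and induce a path with the root at one end; a cherry is a pair of leaves with a common parent. A cograph is caterpillar-explainable if its unique discriminating cotree (labeled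 tree explaining it with adjacent inner vertices differently labeled) is a caterpillar. A $(v,G_1,G_2)$-pseudo-cograph $G$ with $|V(G)|\ge4$ is a $(v,G_1,G_2)$-polar-cat if either ($G_1,G_2$ both connected and $G-v$ the disjoint union of $G_1-v,G_2-v$) or ($G_1,G_2$ both disconnected and $G-v$ the join), and $G_1,G_2$ are caterpillar-explainable with $v$ part of a cherry in both explaining caterpillars. A polar-cat is a $(v,G_1,G_2)$-polar-cat for some $v,G_1,G_2$. *)

(* Defs.v *)
From mathcomp Require Import all_boot.
Set Implicit Arguments.
Unset Strict Implicit.
Unset Printing Implicit Defensive.

Definition connected_in (V : finType) (e : rel V) (S : {set V}) : Prop :=
  forall x y, x \in S -> y \in S ->
    connect [rel u w | [&& u \in S, w \in S & e u w]] x y.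

(* Graphs: a graph G on the finite vertex type T is given by adj : rel T,
   assumed irreflexive and symmetric (simple undirected graph).          *)
Section Graphs.
Variables (T : finType) (adj : rel T).

Definition is_module (M : {set T}) : Prop :=
  forall x y z, x \in M -> y \in M -> z \notin M -> adj x z = adj y z.

Definition primitive : Prop :=
  4 <= #|T| /\
  forall M : {set T}, is_module M -> M = set0 \/ M = setT \/ #|M| = 1.

Definition cograph_on (A : {set T}) : Prop :=
  ~ exists a b c d,
      [/\ a \in A, b \in A, c \in A & d \in A] /\
      uniq [:: a; b; c; d] /\
      [/\ adj a b, adj b c & adj c d] /\
      [/\ ~~ adj a c, ~~ adj b d & ~~ adj a d].

Definition join_parts (v : T) (A B : {set T}) : Prop :=
  forall a b, a \in A :\ v -> b \in B :\ v -> adj a b.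
Definition union_parts (v : T) (A B : {set T}) : Prop :=
  forall a b, a \in A :\ v -> b \in B :\ v -> ~~ adj a b.

Definition pseudo_cograph (v : T) (A B : {set T}) : Prop :=
  [/\ A :|: B = setT, A :&: B = [set v], 1 < #|A| & 1 < #|B|] /\
  cograph_on A /\ cograph_on B /\
  (join_parts v A B \/ union_parts v A B).

End Graphs.

Section Networks.
Variables (W : finType) (arc : rel W).

Definition indeg (v : W) : nat := #|[set u | arc u v]|.
Definition outdeg (v : W) : nat := #|[set w | arc v w]|.

Definition acyclic : Prop := forall u w, arc u w -> ~~ connect arc w u.

Definition leaf (v : W) : bool := outdeg v == 0.
Definition hybrid (v : W) : bool := indeg v == 2.

Definition is_network : Prop :=
  acyclic /\
  (#|W| = 1 \/
   exists r : W,
     [/\ indeg r = 0, 2 <= outdeg r &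
      forall v, v != r ->
        [\/ outdeg v = 0 /\ indeg v = 1,
            indeg v = 1 /\ 2 <= outdeg v
          | indeg v = 2 /\ 1 <= outdeg v]]).

Definition und : rel W := fun u w => arc u w || arc w u.

Definition biconnected_set (S : {set W}) : Prop :=
  connected_in und S /\ forall v, v \in S -> connected_in und (S :\ v).

Definition is_block (S : {set W}) : Prop :=
  biconnected_set S /\
  forall S' : {set W}, S \subset S' -> biconnected_set S' -> S' = S.

Definition level1 : Prop :=
  forall S, is_block S -> #|[set h in S | hybrid h]| <= 1.

Definition is_tree : Prop := is_network /\ forall v, indeg v <= 1.

Definition ancestor (u v : W) : bool := connect arc u v.
Definition is_lca (x y v : W) : Prop :=
  [/\ ancestor v x, ancestor v y &
      forall w, ancestor w x -> ancestor w y -> ancestor v w -> w = v].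

End Networks.

Inductive lab : Type := l0 | l1 | lodot.

Section Labeled.
Variables (T : finType) (adj : rel T) (W : finType) (arc : rel W).

Definition labeling (t : W -> lab) : Prop :=
  forall v, t v = lodot <-> leaf arc v.

Definition explains_on (A : {set T}) (t : W -> lab) (f : T -> W) : Prop :=
  [/\ {in A &, injective f},
      (forall w, leaf arc w <-> exists2 x, x \in A & f x = w) &
      forall x y, x \in A -> y \in A -> x != y ->
        (adj x y <-> exists v, is_lca arc (f x) (f y) v /\ t v = l1)].

Definition discriminating (t : W -> lab) : Prop :=
  forall u w, arc u w -> ~~ leaf arc u -> ~~ leaf arc w -> t u <> t w.

(* caterpillar: every inner vertex has two children, and the inner
   vertices induce a path (in the underlying undirected graph) with the
   root at one end *)
Definition caterpillar : Prop :=
  (forall v, ~~ leaf arc v -> outdeg arc v = 2) /\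
  exists (r : W) (s : seq W),
    [/\ indeg arc r = 0, uniq (r :: s),
        (forall w, (w \in r :: s) = ~~ leaf arc w) &
        forall i j, i < size (r :: s) -> j < size (r :: s) ->
          und arc (nth r (r :: s) i) (nth r (r :: s) j) =
          (i.+1 == j) || (j.+1 == i)].

Definition in_cherry (x : W) : Prop :=
  exists p y, [/\ y != x, leaf arc x, leaf arc y, arc p x & arc p y].

End Labeled.

Definition caterpillar_cherry (T : finType) (adj : rel T)
    (A : {set T}) (v : T) : Prop :=
  exists n (arc : rel 'I_n) (t : 'I_n -> lab) (f : T -> 'I_n),
    [/\ is_tree arc, labeling arc t, discriminating arc t & caterpillar arc] /\
    explains_on adj arc A t f /\ in_cherry arc (f v).

Definition polar_cat_at (T : finType) (adj : rel T)
    (v : T) (A B : {set T}) : Prop :=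
  pseudo_cograph adj v A B /\ 4 <= #|T| /\
  ((connected_in adj A /\ connected_in adj B /\ union_parts adj v A B) \/
   (~ connected_in adj A /\ ~ connected_in adj B /\ join_parts adj v A B)) /\
  caterpillar_cherry adj A v /\ caterpillar_cherry adj B v.

Definition polar_cat (T : finType) (adj : rel T) : Prop :=
  exists v A B, polar_cat_at adj v A B.

Definition level1_explainable (T : finType) (adj : rel T) : Prop :=
  exists n (arc : rel 'I_n) (t : 'I_n -> lab) (f : T -> 'I_n),
    [/\ is_network arc, level1 arc, labeling arc t & explains_on adj arc setT t f].

(* Main.v *)
Require Import Defs.
From mathcomp Require Import all_boot zify.
Set Implicit Arguments.
Unset Strict Implicit.
Unset Printing Implicit Defensive.

(** Both sides of the equivalence amount to the same combinatorial picture: the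
    vertices are [v], a chain [xs] and a chain [ys]; a vertex of a chain is
    adjacent either to everything below it in its chain and to [v], or to none
    of it; [xs] and [ys] are completely joined or completely disjoint; and the
    adjacency type alternates along root, [x_1], [x_2], ... and along root,
    [y_1], [y_2], ...  For a polar-cat the chains are read off the two
    caterpillars from the root to the cherry of [v].

    In a level-1 network explaining a primitive graph, a lowest inner vertex is
    a hybrid [d], since otherwise two leaves below it would be twins.  Let [a]
    be a lowest common ancestor of the two parents of [d], and [Z] the cycle
    through [a] and [d] without [a].  Two cycles of a level-1 network share at
    most one vertex, hence every vertex below [Z] has a unique "gate", the
    vertex at which the paths to it leave [Z].  The leaves with a gate, and the
    leaves with a given gate, form modules.  Primitivity therefore forces every
    leaf to have a gate and gates to be distinct, which is the picture above;
    alternation holds because equal consecutive types would give a module. *)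

(** * Reachability along directed paths *)

Section Connect.
Variables (V : finType) (e : rel V).

(** The step may also use that its source is reachable from [x]; this is what allows invariants that
    hold only below a given vertex. *)
Lemma connect_invariant (P : V -> Prop) x y :
  P x -> (forall u w, connect e x u -> P u -> e u w -> P w) ->
  connect e x y -> P y.
Proof.
move=> Px step /connectP[p]; elim/last_ind: p y => [|p z IH] y /=.
  by move=> _ ->.
rewrite rcons_path last_rcons => /andP[xp ez] ->.
apply: step ez; last exact: IH.
by apply/connectP; exists p.
Qed.

Lemma connect_last_step x y :
  connect e x y -> x = y \/ exists2 p, connect e x p & e p y.
Proof.
case/connectP=> p; elim/last_ind: p => [|p z _] /=; first by left.
rewrite rcons_path last_rcons => /andP[xp ez] ->; right.
by exists (last x p) => //; apply/connectP; exists p.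
Qed.

Lemma connect_first_step x y :
  connect e x y -> x = y \/ exists2 c, e x c & connect e c y.
Proof.
case/connectP=> [[|c p]] /=; first by left.
case/andP=> xc cp ->; right; exists c => //.
by apply/connectP; exists p.
Qed.

Lemma path_connect_last x s y :
  path e x s -> y \in x :: s -> connect e y (last x s).
Proof.
elim: s x y => [|z s IH] x y /=; first by rewrite inE => _ /eqP->.
case/andP=> xz zs; rewrite inE => /orP[/eqP->|/(IH _ _ zs)//].
apply: connect_trans (connect1 xz) _.
by apply: IH; rewrite ?mem_head.
Qed.

End Connect.

(** * Biconnected sets *)

Section Biconnected.
Variables (W : finType) (arc : rel W).
Implicit Types S : {set W}.

Lemma connected_seq (s : seq W) S :
  sorted (und arc) s -> S =i s -> connected_in (und arc) S.
Proof.
move=> ss eS; set e := [rel u w | [&& u \in S, w \in S & und arc u w]].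
have e_sym : connect_sym e.
  by apply: sym_connect_sym => u w /=; rewrite andbCA /und [arc u w || _]orbC.
case: s ss eS => [|x s] /= xs eS; first by move=> u w; rewrite eS.
have es : path e x s.
  have : all (mem S) (x :: s) by apply/allP=> u /= us; rewrite eS.
  elim: s x xs {eS} => //= y s IH x /andP[-> ys] /and3P[xS yS sS].
  by rewrite xS yS IH //= yS.
move=> u w; rewrite !eS => us ws; apply: (@connect_trans _ _ x).
  by rewrite e_sym; apply: (path_connect es) us.
exact: (path_connect es) ws.
Qed.

(** Rotating the cycle so that the deleted vertex comes first shows that a path remains. *)
Lemma biconnected_cycle (c : seq W) S :
  cycle (und arc) c -> uniq c -> S =i c -> biconnected_set arc S.
Proof.
move=> cc uc eS; split=> [|v vS].
  apply: (connected_seq (s := c)) => //.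
  case: c cc {uc eS} => //= x c; rewrite rcons_path => /andP[]//.
have vc : v \in c by rewrite -eS.
case: (rot_to vc) => i c' rc'.
have uc' : uniq (v :: c') by rewrite -rc' rot_uniq.
apply: (connected_seq (s := c')).
  move: cc; rewrite -(rot_cycle i) rc' /= rcons_path => /andP[+ _].
  exact: path_sorted.
move=> x; rewrite !inE eS -(mem_rot i) rc' inE.
by case: eqP => [->|]//=; case/andP: uc' => /negbTE->.
Qed.

Lemma connected_union S1 S2 a :
  connected_in (und arc) S1 -> connected_in (und arc) S2 ->
  a \in S1 -> a \in S2 -> connected_in (und arc) (S1 :|: S2).
Proof.
move=> c1 c2 a1 a2.
set e := [rel u w | [&& u \in S1 :|: S2, w \in S1 :|: S2 & und arc u w]].
have sub S : S \subset S1 :|: S2 -> forall u w,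
    connect [rel u w | [&& u \in S, w \in S & und arc u w]] u w -> connect e u w.
  move=> /subsetP sS; apply: connect_sub => u w /and3P[uS wS uw].
  by apply: connect1; rewrite /= !sS.
have s1 := sub S1 (subsetUl _ _); have s2 := sub S2 (subsetUr _ _).
move=> u w uS wS; apply: (@connect_trans _ _ a).
  by case/setUP: uS => uS; [apply/s1/c1 | apply/s2/c2].
by case/setUP: wS => wS; [apply/s1/c1 | apply/s2/c2].
Qed.

(** Whatever vertex is deleted, one of the two common vertices survives and links the two connected
    remainders. *)
Lemma biconnected_union S1 S2 a b :
  biconnected_set arc S1 -> biconnected_set arc S2 -> a != b ->
  a \in S1 :&: S2 -> b \in S1 :&: S2 -> biconnected_set arc (S1 :|: S2).
Proof.
move=> [c1 b1] [c2 b2] nab /setIP[a1 a2] /setIP[b1' b2'].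
split; first exact: connected_union a1 a2.
have del S v : connected_in (und arc) S ->
    (forall v, v \in S -> connected_in (und arc) (S :\ v)) ->
    connected_in (und arc) (S :\ v).
  move=> cS bS; case: (boolP (v \in S)) => [/bS//|vS].
  by rewrite (setDidPl _) // disjoint_sym disjoints1.
move=> v _; rewrite setDUl.
have [eav|nav] := eqVneq a v.
  apply: (connected_union (a := b)); try exact: del; rewrite !inE -eav eq_sym nab //.
by apply: (connected_union (a := a)); try exact: del; rewrite !inE nav.
Qed.

(** The definition of [level1] speaks only of blocks. A biconnected set that is not maximal is
    enlarged, by induction on the number of vertices outside it, until a block is reached; hybrids
    are never lost on the way. *)
Lemma level1_biconnected S :
  level1 arc -> biconnected_set arc S -> #|[set h in S | hybrid arc h]| <= 1.
Proof.
move=> l1; move: {2}_.+1 (ltnSn (#|W| - #|S|)) => n.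
elim: n S => // n IH S ltn bS; rewrite leqNgt; apply/negP=> gt1.
have: is_block arc S.
  split=> // S' sSS' bS'; apply/eqP; apply: contraTT gt1 => neS'.
  have ltS : S \proper S' by rewrite properEneq eq_sym neS'.
  have ltS2 := proper_card ltS; have leS' : #|S'| <= #|W| := max_card _.
  have ltn' : #|W| - #|S'| < n by lia.
  rewrite -leqNgt; apply: leq_trans (IH S' ltn' bS').
  apply/subset_leq_card/subsetP=> h; rewrite !inE => /andP[hS ->].
  by rewrite (subsetP sSS').
by move/l1; rewrite leqNgt gt1.
Qed.

Lemma level1_hybrid_eq S h k :
  level1 arc -> biconnected_set arc S -> h \in S -> k \in S ->
  hybrid arc h -> hybrid arc k -> h = k.
Proof.
move=> l1 bS hS kS hh hk; apply/eqP; apply: contraTT (level1_biconnected l1 bS).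
move=> neq; rewrite -ltnNge; apply/card_gt1P.
by exists h, k; rewrite !inE hS kS hh hk.
Qed.

End Biconnected.

(** * Networks *)

Section Network.
Variables (W : finType) (arc : rel W).
Local Notation anc := (connect arc).

Lemma acyclic_antisym u w : acyclic arc -> anc u w -> anc w u -> u = w.
Proof.
move=> acy; case/connect_first_step=> // -[c uc cw] wu.
by have := acy _ _ uc; rewrite (connect_trans cw wu).
Qed.

Lemma acyclic_arcF u w : acyclic arc -> arc u w -> anc w u -> False.
Proof. by move=> acy /acy /negbTE->. Qed.

Lemma acyclic_ranked (rk : W -> nat) :
  (forall u w, arc u w -> rk u < rk w) -> acyclic arc.
Proof.
move=> rk_arc u w uw; apply/negP=> wu.
have : rk w <= rk u.
  apply: (connect_invariant (P := fun x => rk w <= rk x)) wu => // x y _ le_wx.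
  by move=> /rk_arc /ltnW; apply: leq_trans.
by rewrite leqNgt rk_arc.
Qed.

(** Induction on the number of ancestors, which drops strictly from a vertex to its parents. *)
Lemma arc_ind (P : W -> Prop) :
  acyclic arc -> (forall w, (forall u, arc u w -> P u) -> P w) -> forall w, P w.
Proof.
move=> acy step w; move: {2}_.+1 (ltnSn #|[set u | anc u w]|) => n.
elim: n w => // n IH w; rewrite ltnS => ltn; apply: step => u uw; apply: IH.
apply: leq_trans ltn; apply: proper_card; apply/properP; split.
  by apply/subsetP=> x; rewrite !inE => xu; apply: connect_trans xu (connect1 uw).
by exists w; rewrite !inE ?connect0 ?acy.
Qed.

Lemma arc_ind_down (P : W -> Prop) :
  acyclic arc -> (forall w, (forall u, arc w u -> P u) -> P w) -> forall w, P w.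
Proof.
move=> acy step w; move: {2}_.+1 (ltnSn #|[set u | anc w u]|) => n.
elim: n w => // n IH w; rewrite ltnS => ltn; apply: step => u wu; apply: IH.
apply: leq_trans ltn; apply: proper_card; apply/properP; split.
  by apply/subsetP=> x; rewrite !inE => ux; apply: connect_trans (connect1 wu) ux.
by exists w; rewrite !inE ?connect0 ?acy.
Qed.

Lemma leafPn w : reflect (exists c, arc w c) (~~ leaf arc w).
Proof.
rewrite /leaf /outdeg -lt0n; apply: (iffP card_gt0P).
  by case=> c; rewrite inE; exists c.
by case=> c wc; exists c; rewrite inE.
Qed.

Lemma leaf_arcF w c : leaf arc w -> arc w c -> False.
Proof. by move=> lw wc; case/negP: (introT (leafPn w) (ex_intro _ c wc)). Qed.

Lemma leaf_connect w x : leaf arc w -> anc w x -> w = x.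
Proof. by move=> lw /connect_first_step[//|[c wc]]; case: (leaf_arcF lw wc). Qed.

Lemma leaf_below w : acyclic arc -> exists2 x, leaf arc x & anc w x.
Proof.
move=> acy; move: w; apply: (arc_ind_down acy) => w IH.
have [lw|/leafPn[c wc]] := boolP (leaf arc w); first by exists w.
by have [x lx cx] := IH c wc; exists x => //; apply: connect_trans (connect1 wc) cx.
Qed.

Lemma outdeg_ge2 w : 2 <= outdeg arc w -> exists c c', [/\ c != c', arc w c & arc w c'].
Proof. by case/card_gt1P=> c [c' []]; rewrite !inE => *; exists c, c'. Qed.

Lemma outdeg2 w c c' d :
  outdeg arc w = 2 -> c != c' -> arc w c -> arc w c' -> arc w d ->
  (d == c) || (d == c').
Proof.
move=> o2 ne wc wc' wd.
have /eqP e : [set c; c'] == [set u | arc w u].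
  rewrite eqEcard -/(outdeg arc w) o2 cards2 ne andbT.
  by apply/subsetP=> x; rewrite !inE => /orP[]/eqP->.
have : d \in [set u | arc w u] by rewrite inE.
by rewrite -e !inE.
Qed.

Lemma indeg1_unique w u u' : indeg arc w <= 1 -> arc u w -> arc u' w -> u = u'.
Proof. by move=> /card_le1P/(_ u); rewrite inE => H /H/(_ u'); rewrite !inE => -> /eqP. Qed.

Section IsNetwork.
Hypothesis net : is_network arc.

Lemma network_acyclic : acyclic arc. Proof. by case: net. Qed.
Let acy := network_acyclic.

Lemma card1_arcF u w : #|W| = 1 -> arc u w -> False.
Proof.
move=> c1 uw; have := acy uw.
have /fintype1P[r er] : #|W| == 1 by rewrite c1.
by rewrite (er u) (er w) connect0.
Qed.

Lemma network_root : exists r, forall w, anc r w.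
Proof.
case: net => _ [c1|[r [_ _ Hr]]].
  have /fintype1P[r er] : #|W| == 1 by rewrite c1.
  by exists r => w; rewrite (er w).
exists r; apply: (arc_ind acy) => w IH.
have [->//|wr] := eqVneq w r.
have : 0 < indeg arc w by case: (Hr w wr) => -[] ?; lia.
case/card_gt0P=> u; rewrite inE => uw.
exact: connect_trans (IH u uw) (connect1 uw).
Qed.

Lemma nonhybrid_indeg w : ~~ hybrid arc w -> indeg arc w <= 1.
Proof.
rewrite /hybrid; case: net => _ [c1|[r [r0 _ Hr]]].
  move=> _; rewrite (_ : indeg arc w = 0) //.
  by apply/eqP; rewrite cards_eq0; apply/eqP/setP=> u; rewrite !inE; apply/negP=> /(card1_arcF c1).
have [->|wr] := eqVneq w r; first by rewrite r0.
by case: (Hr w wr) => -[]; lia.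
Qed.

Lemma nonhybrid_parent w u u' : ~~ hybrid arc w -> arc u w -> arc u' w -> u = u'.
Proof. by move/nonhybrid_indeg; apply: indeg1_unique. Qed.

Lemma nonhybrid_outdeg w :
  ~~ hybrid arc w -> ~~ leaf arc w -> 2 <= outdeg arc w.
Proof.
rewrite /hybrid; case: net => _ [c1 _ /leafPn[c]|[r [_ r2 Hr]]].
  by move/(card1_arcF c1).
have [->//|wr] := eqVneq w r; rewrite /leaf.
by case: (Hr w wr) => -[]; lia.
Qed.

Lemma leaf_nonhybrid w : leaf arc w -> ~~ hybrid arc w.
Proof.
rewrite /leaf /hybrid; case: net => _ [c1 _|[r [r0 r2 Hr]]].
  apply/eqP=> i2; have : 0 < indeg arc w by rewrite i2.
  by case/card_gt0P=> u; rewrite inE => /(card1_arcF c1).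
have [->//|wr] := eqVneq w r; first by rewrite r0.
by case: (Hr w wr) => -[]; lia.
Qed.

Lemma hybrid_parents h : hybrid arc h ->
  exists p q, [/\ p != q, arc p h, arc q h & forall u, arc u h -> u = p \/ u = q].
Proof.
rewrite /hybrid /indeg => /cards2P[p [q [npq e]]]; exists p, q.
have E u : arc u h = (u == p) || (u == q).
  by have := in_set (arc^~ h) u; rewrite e !inE => ->.
split=> //; rewrite ?E ?eqxx ?orbT // => u.
by rewrite E => /orP[]/eqP->; [left|right].
Qed.

End IsNetwork.

(** A common ancestor that lies below all others is the only minimal one, so the existential in
    [explains_on] collapses to its label. *)
Lemma lca_greatest x y m (t : W -> lab) :
  acyclic arc -> anc m x -> anc m y ->
  (forall w, anc w x -> anc w y -> anc w m) ->
  (exists v, is_lca arc x y v /\ t v = l1) <-> t m = l1.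
Proof.
move=> acy mx my mg; split=> [[v [[vx vy vmax] tv]]|tm].
  by rewrite (vmax m) //; apply: mg.
exists m; split=> //; split=> // w wx wy mw.
by apply: (acyclic_antisym acy) (mg _ wx wy) mw.
Qed.

(** Being a lowest common ancestor depends only on the set of common ancestors. Adjacencies can
    therefore be compared without computing any lowest common ancestor. *)
Lemma is_lca_ext x y x' y' v :
  (forall w, anc w x && anc w y = anc w x' && anc w y') ->
  is_lca arc x y v -> is_lca arc x' y' v.
Proof.
move=> e [vx vy vmax]; have := e v; rewrite (vx : anc v x) (vy : anc v y) => /esym/andP[vx' vy'].
split=> // w wx' wy' vw; have := e w; rewrite (wx' : anc w x') (wy' : anc w y') => /andP[wx wy].
exact: vmax.
Qed.

End Network.

(** * Graphs explained by a network *)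

Section Explains.
Variables (T : finType) (adj : rel T) (W : finType) (arc : rel W).
Variables (A : {set T}) (t : W -> lab) (f : T -> W).
Hypothesis expl : explains_on adj arc A t f.
Local Notation anc := (connect arc).

Lemma explained_adj_eq x y x' y' :
  x \in A -> y \in A -> x' \in A -> y' \in A -> x != y -> x' != y' ->
  (forall w, anc w (f x) && anc w (f y) = anc w (f x') && anc w (f y')) ->
  adj x y = adj x' y'.
Proof.
case: expl => _ _ ex xA yA x'A y'A nxy nxy' e; apply/idP/idP => /ex.
  by case=> // v [lv tv]; apply/ex => //; exists v; split=> //; apply: is_lca_ext lv.
case=> // v [lv tv]; apply/ex => //; exists v; split=> //.
by apply: is_lca_ext lv => w; rewrite e.
Qed.

Lemma explains_leaf x : x \in A -> leaf arc (f x).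
Proof. by case: expl => _ lf _ xA; apply/lf; exists x. Qed.

End Explains.

(** * Cycles of a level-1 network *)

Section HybridCycle.
Variables (W : finType) (arc : rel W).
Hypotheses (net : is_network arc) (lev : level1 arc).
Local Notation anc := (connect arc).
Let acy : acyclic arc := network_acyclic net.

(** Two directed sides run from the top [a] to the two parents of [d]. The lists omit [a], so a side
    is empty when [a] itself is a parent of [d]. *)
Record hybrid_cycle (d a : W) (ps qs : seq W) : Prop := HybridCycle {
  hc_pathl : path arc a ps;
  hc_pathr : path arc a qs;
  hc_lastl : arc (last a ps) d;
  hc_lastr : arc (last a qs) d;
  hc_neq : last a ps != last a qs;
  hc_uniq : uniq (d :: a :: ps ++ qs);
  hc_parents : forall u, arc u d -> u = last a ps \/ u = last a qs }.

Lemma hybrid_cycle_sym d a ps qs : hybrid_cycle d a ps qs -> hybrid_cycle d a qs ps.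
Proof.
case=> pp pq lp lq ne un par; split=> //; first by rewrite eq_sym.
  by rewrite -!cat_cons (perm_uniq (s2 := d :: a :: ps ++ qs)) // !perm_cons perm_catC.
by move=> u /par[]; [right|left].
Qed.

(** Descend from the root as long as some child is still above both vertices. *)
Lemma lowest_common_ancestor p q :
  exists a, [/\ anc a p, anc a q & forall c, arc a c -> ~~ (anc c p && anc c q)].
Proof.
have [r rr] := network_root net.
have: anc r p -> anc r q ->
  exists a, [/\ anc a p, anc a q & forall c, arc a c -> ~~ (anc c p && anc c q)].
  move: r {rr}; apply: (arc_ind_down acy) => w IH wp wq.
  have [/existsP[c /and3P[wc cp cq]]|/existsPn none] :=
    boolP [exists c, [&& arc w c, anc c p & anc c q]]; first exact: IH cp cq.
  by exists w; split=> // c wc; have := none c; rewrite wc.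
exact.
Qed.

Lemma path_strict_connect (a : W) s c :
  path arc a s -> c \in s -> exists2 b, arc a b & anc b c.
Proof.
case: s => //= b s /andP[ab bs] cs; exists b => //.
exact: path_connect bs _ cs.
Qed.

Lemma hybrid_cycle_exists d : hybrid arc d -> exists a ps qs, hybrid_cycle d a ps qs.
Proof.
move=> hd; have [p [q [npq pd qd par]]] := hybrid_parents hd.
have [a [ap aq amin]] := lowest_common_ancestor p q.
case/connectP: ap => s /shortenP[ps pps ups _] ep {s}.
case/connectP: aq => s /shortenP[qs pqs uqs _] eq {s}.
exists a, ps, qs; split=> //; rewrite -?ep -?eq //.
have notd s : path arc a s -> arc (last a s) d -> d \notin a :: s.
  move=> pas ld; apply/negP=> /(path_connect_last pas).
  exact: acyclic_arcF ld.
have := notd _ pps; rewrite -ep => /(_ pd) dps.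
have := notd _ pqs; rewrite -eq => /(_ qd) dqs.
move: ups uqs => /= /andP[aps ups] /andP[aqs uqs].
move: dps dqs; rewrite !in_cons !negb_or => /andP[da dps] /andP[_ dqs].
rewrite /= !mem_cat !negb_or da dps dqs aps aqs cat_uniq ups uqs /= andbT.
apply/hasPn=> c cqs; apply/negP=> cps.
(* A vertex shared by the two sides would put a child of [a] above both parents of [d], against the
   choice of [a]. *)
have [b ab bc] := path_strict_connect pps cps.
have cp : anc c p by rewrite ep; apply: path_connect_last => //; rewrite inE cps orbT.
have cq : anc c q by rewrite eq; apply: path_connect_last => //; rewrite inE cqs orbT.
by have := amin b ab; rewrite (connect_trans bc cp) (connect_trans bc cq).
Qed.

Lemma path_pred (a : W) s c :
  path arc a s -> c \in s -> exists2 u, u \in a :: s & arc u c.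
Proof.
elim: s a => //= b s IH a /andP[ab bs]; rewrite inE => /orP[/eqP->|cs].
  by exists a; rewrite // mem_head.
by have [u us uc] := IH b bs cs; exists u; rewrite // inE us orbT.
Qed.

Definition cycle_set d a (ps qs : seq W) : {set W} := [set x in d :: a :: ps ++ qs].

Lemma cycle_biconnected d a ps qs :
  hybrid_cycle d a ps qs -> biconnected_set arc (cycle_set d a ps qs).
Proof.
case=> pp pq lp lq ne un par.
have sub s b : path arc b s -> path (und arc) b s.
  by apply: sub_path => x y xy; rewrite /und xy.
(* The undirected cycle goes down one side to [d] and back up the other. *)
apply: (biconnected_cycle (c := a :: ps ++ d :: rev qs)).
- rewrite /= rcons_path cat_path sub //= last_cat /= {1}/und lp /=.
  have := rcons_path (und arc) d (rev qs) a => <-.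
  rewrite -rev_cons lastI rev_rcons /= {1}/und lq orbT rev_path.
  rewrite (eq_path (e' := und arc)) ?sub // => x y.
  by rewrite /und orbC.
- rewrite (perm_uniq (s2 := d :: a :: ps ++ qs)) //.
  rewrite -cat_cons perm_catC /= perm_cons perm_catC /= perm_cons perm_cat2l.
  by rewrite perm_rev.
move=> x; rewrite !inE !mem_cat inE mem_rev.
by do !case: (_ == _); rewrite ?orbT // orbCA.
Qed.

Section Fixed.
Variables (d a : W) (ps qs : seq W).
Hypothesis hc : hybrid_cycle d a ps qs.
Hypothesis hd : hybrid arc d.

(** The cycle is biconnected, so level 1 leaves [d] as its only hybrid. *)
Lemma cycle_nonhybrid x : x \in a :: ps ++ qs -> ~~ hybrid arc x.
Proof.
move=> xs; apply/negP=> hx; have := hc_uniq hc; rewrite cons_uniq => /andP[/negP[]].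
rewrite -(level1_hybrid_eq lev (cycle_biconnected hc) _ _ hx hd) //.
  by rewrite inE in_cons xs orbT.
by rewrite inE mem_head.
Qed.

End Fixed.

(** The only parent of a non-hybrid vertex of the chain is its predecessor, so going upwards one
    stays on the chain until [a]. *)
Lemma chain_anc (a : W) s z w :
  path arc a s -> (forall x, x \in s -> ~~ hybrid arc x) ->
  z \in s -> anc w z -> w \in s \/ anc w a.
Proof.
move=> pas nh; move: z; apply: (arc_ind acy) => z IH zs wz.
case/connect_last_step: (wz) => [->|[p wp pz]]; first by left.
have [u us uz] := path_pred pas zs.
have epu := nonhybrid_parent net (nh z zs) pz uz.
move: us; rewrite -epu inE => /orP[/eqP ea|ps]; first by right; rewrite -ea.
exact: (IH p).
Qed.

Lemma path_transfer (a : W) s (P : W -> Prop) :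
  path arc a s -> (forall u w, w \in s -> arc u w -> P w <-> P u) ->
  P (last a s) <-> P a.
Proof.
elim: s a => //= b s IH a /andP[ab bs] tr.
rewrite IH //; first by apply: tr; rewrite ?mem_head.
by move=> u w ws; apply: tr; rewrite inE ws orbT.
Qed.

Section Gate.
Variables (d a : W) (ps qs : seq W).
Hypothesis hc : hybrid_cycle d a ps qs.
Hypothesis hd : hybrid arc d.
Local Notation Z := (d :: ps ++ qs).

(* [Z] is the cycle without its top [a]; [gate z u] says that some path to [u] leaves [Z] at [z]. *)
Definition gate (z u : W) : bool :=
  (z \in Z) && connect [rel x y | arc x y && (y \notin Z)] z u.

Lemma cycle_chains_nonhybrid x : x \in ps ++ qs -> ~~ hybrid arc x.
Proof. by move=> xs; apply: (cycle_nonhybrid hc hd); rewrite inE xs orbT. Qed.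

Lemma chain_anc_top z w : z \in ps ++ qs -> anc w z -> w \in ps ++ qs \/ anc w a.
Proof.
have nh := cycle_chains_nonhybrid.
rewrite mem_cat => /orP[zs|zs] wz.
  have [|wp|] := chain_anc (hc_pathl hc) _ zs wz; last by right.
    by move=> x xs; apply: nh; rewrite mem_cat xs.
  by left; rewrite mem_cat wp.
have [|wp|] := chain_anc (hc_pathr hc) _ zs wz; last by right.
  by move=> x xs; apply: nh; rewrite mem_cat xs orbT.
by left; rewrite mem_cat wp orbT.
Qed.

Lemma last_mem_chains u : arc u d -> u = a \/ u \in ps ++ qs.
Proof.
case/(hc_parents hc)=> ->; [have := mem_last a ps | have := mem_last a qs];
  by rewrite inE mem_cat => /orP[/eqP|] ->; rewrite ?orbT; [left|right].
Qed.

(** Upwards the cycle can be left only through its top, because all parents of vertices of [Z] are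
    in [Z] or equal to [a]. *)
Lemma cycle_anc z w : z \in Z -> anc w z -> w \in Z \/ anc w a.
Proof.
have chain z' : z' \in ps ++ qs -> anc w z' -> w \in Z \/ anc w a.
  by move=> z's /(chain_anc_top z's)[ws|wa]; [left; rewrite inE ws orbT | right].
rewrite inE => /orP[/eqP->|]; last exact: chain.
case/connect_last_step=> [->|[p wp pd]]; first by left; rewrite mem_head.
by case: (last_mem_chains pd) => [<-|/chain]; [right|exact].
Qed.

Lemma cycle_top z : z \in Z -> anc a z.
Proof.
have chain z' : z' \in ps ++ qs -> anc a z'.
  rewrite mem_cat => /orP[z's|z's].
    by apply: path_connect (hc_pathl hc) _ _; rewrite inE z's orbT.
  by apply: path_connect (hc_pathr hc) _ _; rewrite inE z's orbT.
rewrite inE => /orP[/eqP->|/chain//].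
apply: connect_trans (connect1 (hc_lastl hc)).
exact: path_connect (hc_pathl hc) _ (mem_last _ _).
Qed.

Lemma gate_refl z : z \in Z -> gate z z.
Proof. by move=> zZ; rewrite /gate zZ connect0. Qed.

Lemma gate_mem z u : gate z u -> z \in Z.
Proof. by case/andP. Qed.

Lemma gate_connect z u : gate z u -> anc z u.
Proof.
case/andP=> _; apply: connect_sub => x y /andP[xy _]; exact: connect1.
Qed.

Lemma gate_last z u :
  gate z u -> u != z -> u \notin Z /\ exists2 p, gate z p & arc p u.
Proof.
case/andP=> zZ /connect_last_step[->|[p zp /andP[pu uZ]] _]; first by rewrite eqxx.
by split=> //; exists p; rewrite // /gate zZ.
Qed.

Lemma gate_cycle z u : gate z u -> u \in Z -> u = z.
Proof.
by move=> g uZ; have [//|/(gate_last g)[]] := eqVneq u z; rewrite uZ.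
Qed.

Lemma gate_arc z u w : gate z u -> arc u w -> w \notin Z -> gate z w.
Proof.
case/andP=> zZ zu uw wZ; rewrite /gate zZ; apply: connect_trans zu (connect1 _).
by rewrite /= uw.
Qed.

(* Two cycles sharing an arc would lie in a common block with two hybrids. *)
Lemma other_cycle_avoids u b rs ss w :
  hybrid_cycle u b rs ss -> hybrid arc u -> u != d -> w \in rs ++ ss -> w \notin Z.
Proof.
move=> hc' hu nud ws; apply/negP=> wZ.
have nhw : ~~ hybrid arc w by apply: (cycle_nonhybrid hc' hu); rewrite inE ws orbT.
have pred d' a' ps' qs' : hybrid_cycle d' a' ps' qs' -> w \in ps' ++ qs' ->
    exists2 p, p \in cycle_set d' a' ps' qs' & arc p w.
  case=> pp pq _ _ _ _ _; rewrite mem_cat => ws'.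
  have [p pin pw] : exists2 p, (p \in a' :: ps') || (p \in a' :: qs') & arc p w.
    case/orP: ws' => [/(path_pred pp)|/(path_pred pq)] [p pin pw];
      by exists p; rewrite // pin ?orbT.
  exists p => //; move: pin; rewrite !inE mem_cat.
  by case: (p == a'); case: (p \in ps'); case: (p \in qs'); rewrite ?orbT.
have wpq : w \in ps ++ qs.
  by move: wZ; rewrite inE => /orP[/eqP ewd|//]; rewrite ewd hd in nhw.
have [p pS pw] := pred _ _ _ _ hc wpq.
have [p' pS' p'w] := pred _ _ _ _ hc' ws.
(* The unique parent of [w] lies on both cycles as well, so they share the two vertices that
   [biconnected_union] requires. *)
have epp := nonhybrid_parent net nhw p'w pw; subst p'.
have npw : p != w.
  by apply/eqP=> epw; apply: (acyclic_arcF acy pw); rewrite epw connect0.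
have bU := biconnected_union (cycle_biconnected hc) (cycle_biconnected hc') npw.
have {}bU := bU (introT setIP (conj pS pS')).
move/eqP: nud; apply; apply: (level1_hybrid_eq lev _ _ _ hu hd); first apply: bU.
- by rewrite !inE ws wpq !orbT.
- by rewrite !inE eqxx !orbT.
by rewrite !inE eqxx.
Qed.

(* If [u] is a hybrid, the gate of one parent is carried up one side of the cycle
   below [u] to its top, and down the other side to the other parent. *)
Lemma gate_up z u p : gate z u -> u != z -> arc p u -> gate z p.
Proof.
move=> zu nuz pu; have [uZ [p0 zp0 p0u]] := gate_last zu nuz.
have nud : u != d by apply: contraNneq uZ => ->; rewrite mem_head.
have [hu|nhu] := boolP (hybrid arc u); last first.
  by rewrite (nonhybrid_parent net nhu pu p0u).
have [b [rs [ss hc']]] := hybrid_cycle_exists hu.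
have tr u' w : w \in rs ++ ss -> arc u' w -> gate z w <-> gate z u'.
  move=> ws u'w; have wZ := other_cycle_avoids hc' hu nud ws.
  have nhw : ~~ hybrid arc w by apply: (cycle_nonhybrid hc' hu); rewrite inE ws orbT.
  split=> [zw|zu']; last exact: gate_arc u'w wZ.
  have nwz : w != z by apply: contraNneq wZ => ->; apply: gate_mem zu.
  have [_ [u'' zu'' u''w]] := gate_last zw nwz.
  by rewrite (nonhybrid_parent net nhw u'w u''w).
have top p' : arc p' u -> gate z p' <-> gate z b.
  case/(hc_parents hc')=> ->.
    apply: (path_transfer (P := gate z) (hc_pathl hc')) => u' w ws.
    by apply: tr; rewrite mem_cat ws.
  apply: (path_transfer (P := gate z) (hc_pathr hc')) => u' w ws.
  by apply: tr; rewrite mem_cat ws orbT.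
by apply/(top p pu)/(top p0 p0u).
Qed.

Lemma gate_inj z z' u : gate z u -> gate z' u -> z = z'.
Proof.
move: u; apply: (arc_ind acy) => u IH zu z'u.
have [euz|nuz] := eqVneq u z.
  by rewrite -euz; apply: gate_cycle z'u _; rewrite euz; apply: gate_mem zu.
have [_ [p zp pu]] := gate_last zu nuz.
apply: (IH p pu zp); have [euz'|nuz'] := eqVneq u z'; last exact: gate_up z'u nuz' pu.
by have /negP[] := (gate_last zu nuz).1; rewrite euz'; apply: gate_mem z'u.
Qed.

Lemma gate_anc z u w : gate z u -> anc w u -> gate z w \/ anc w z.
Proof.
move: u; apply: (arc_ind acy) => u IH zu.
case/connect_last_step=> [->|[p wp pu]]; first by left.
have [euz|nuz] := eqVneq u z.
  by right; rewrite -euz; apply: connect_trans wp (connect1 pu).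
exact: IH pu (gate_up zu nuz pu) wp.
Qed.

(** A downward path may re-enter [Z], where the gate changes, so only the existence of some gate is
    inherited. *)
Lemma gate_down z u w : gate z u -> anc u w -> exists z', gate z' w.
Proof.
move=> zu; apply: (connect_invariant (P := fun w => exists z', gate z' w)).
  by exists z.
move=> x y _ [z' z'x] xy; have [yZ|yZ] := boolP (y \in Z).
  by exists y; apply: gate_refl.
by exists z'; apply: gate_arc xy yZ.
Qed.

(** For lowest common ancestors, vertices behind distinct gates may be replaced by their gates: a
    vertex above both cannot have two gates, so it is above at least one of the two cycle
    vertices. *)
Lemma gate_common_anc z z' x y w : gate z x -> gate z' y -> z != z' ->
  anc w x && anc w y = anc w z && anc w z'.
Proof.
move=> zx zy nz; apply/andP/andP=> -[wx wy]; last first.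
  by split; [exact: connect_trans wx (gate_connect zx) | exact: connect_trans wy (gate_connect zy)].
(* A vertex with gate [u] that is also above a cycle vertex is either on the cycle, hence [u]
   itself, or above the top [a]. *)
have half u v : gate u w -> u \in Z -> v \in Z -> anc w v -> anc w u.
  move=> uw uZ vZ wv; case: (cycle_anc vZ wv) => [wZ|wa].
    by rewrite (gate_cycle uw wZ) connect0.
  exact: connect_trans wa (cycle_top uZ).
have zZ := gate_mem zx; have z'Z := gate_mem zy.
case: (gate_anc zx wx) (gate_anc zy wy) => [zw|wz] [z'w|wz'] //.
- by rewrite (gate_inj zw z'w) eqxx in nz.
- by split=> //; apply: half zw _ _ wz'.
by split=> //; apply: half z'w _ _ wz.
Qed.

End Gate.
End HybridCycle.

(* [xs] and [ys] list the leaves of two caterpillars from the root to the cherry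
   containing [v]; the label of the parent of [x] is recovered as [adj x v]. *)
Record caterpillar_pair (T : finType) (adj : rel T) (v : T) (xs ys : seq T) (b : bool)
  : Prop := CaterpillarPair {
  cp_uniq : uniq (v :: xs ++ ys);
  cp_cover : forall x, x \in v :: xs ++ ys;
  cp_left : pairwise (fun x y => adj x y == adj x v) xs;
  cp_right : pairwise (fun x y => adj x y == adj x v) ys;
  cp_cross : allrel (fun x y => adj x y == b) xs ys }.

(** * The leaves around a cycle when the explained graph is primitive *)

Section CycleLeaves.
Variables (T : finType) (adj : rel T) (W : finType) (arc : rel W).
Variables (t : W -> lab) (f : T -> W).
Hypotheses (prim : primitive adj).
Hypotheses (net : is_network arc) (lev : level1 arc).
Hypothesis expl : explains_on adj arc setT t f.
Local Notation anc := (connect arc).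
Let acy : acyclic arc := network_acyclic net.

(** Adjacency to [s] is determined by the common ancestors with [s], so it is enough to describe
    these by a predicate [g s] that does not mention the element of [M]. *)
Lemma explained_module (M : {set T}) (g : T -> W -> bool) :
  (forall x s w, x \in M -> s \notin M -> anc w (f x) && anc w (f s) = g s w) ->
  is_module adj M.
Proof.
move=> H x y s xM yM sM.
have ne z : z \in M -> z != s by apply: contraTneq => ->.
apply: (explained_adj_eq expl); rewrite ?inE ?ne // => w.
by rewrite !H.
Qed.

Lemma primitive_module (M : {set T}) x y :
  is_module adj M -> x \in M -> y \in M -> x != y -> M = setT.
Proof.
move=> mM xM yM nxy; case: (prim.2 M mM) => [e|[//|/eqP/cards1P[z e]]].
  by rewrite e inE in xM.
by move: xM yM nxy; rewrite e !inE => /eqP-> /eqP->; rewrite eqxx.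
Qed.

Lemma leafE w : leaf arc w -> exists x, f x = w.
Proof. by case: expl => _ lf _ /lf[x _]; exists x. Qed.

Lemma finj : injective f.
Proof. by case: expl => fi _ _ x y; apply: fi; rewrite !inE. Qed.

Lemma two_vertices : exists x y : T, x != y.
Proof.
have /card_gt1P[x [y [_ _ nxy]]] : 1 < #|T| by case: prim; lia.
by exists x, y.
Qed.

(* Two leaves hanging from the same non-hybrid vertex are twins, so a lowest inner
   vertex is a hybrid. *)
Lemma hybrid_exists : exists d, hybrid arc d.
Proof.
have [x [y nxy]] := two_vertices.
have [r rr] := network_root net.
have nlr : ~~ leaf arc r.
  apply: contra nxy => lr; apply/eqP/finj.
  by rewrite -(leaf_connect lr (rr (f x))) -(leaf_connect lr (rr (f y))).
have [w nlw cw] : exists2 w, ~~ leaf arc w & forall c, arc w c -> leaf arc c.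
  move: r nlr {rr}; apply: (arc_ind_down acy) => w IH nlw.
  have [/existsP[c /andP[wc nlc]]|/existsPn H] := boolP [exists c, arc w c && ~~ leaf arc c].
    exact: IH nlc.
  by exists w => // c wc; have := H c; rewrite wc negbK.
exists w; apply: contraT => nhw.
have [c [c' [ncc wc wc']]] := outdeg_ge2 (nonhybrid_outdeg net nhw nlw).
have [p ep] := leafE (cw _ wc); have [q eq] := leafE (cw _ wc').
have npq : p != q by apply: contraNneq ncc; rewrite -ep -eq => ->.
have mod : is_module adj [set p; q].
  apply: (explained_module (g := fun s u => anc u w && anc u (f s))) => z s u zM sM.
  have wz : arc w (f z) by move: zM; rewrite !inE => /orP[]/eqP->; rewrite ?ep ?eq.
  have lz := cw _ wz.
  apply/andP/andP=> -[uz us]; split=> //; last exact: connect_trans uz (connect1 wz).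
  case/connect_last_step: uz => [euz|[w' uw' w'z]].
    rewrite euz in us; have /finj ezs := leaf_connect lz us.
    by rewrite -ezs zM in sM.
  by rewrite (nonhybrid_parent net (leaf_nonhybrid net lz) wz w'z).
have e : [set p; q] = setT by apply: primitive_module mod _ _ npq; rewrite !inE eqxx ?orbT.
by have := prim.1; rewrite -cardsT -e cards2 npq.
Qed.

Section HangingChild.
Variables (d a : W) (ps qs : seq W).
Hypothesis hc : hybrid_cycle arc d a ps qs.
Hypothesis hd : hybrid arc d.
Local Notation Z := (d :: ps ++ qs).

Lemma cycle_bottom z : z \in Z -> anc z d.
Proof.
rewrite inE mem_cat => /orP[/eqP->//|/orP[zs|zs]].
  apply: connect_trans (connect1 (hc_lastl hc)).
  by apply: path_connect_last (hc_pathl hc) _; rewrite inE zs orbT.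
apply: connect_trans (connect1 (hc_lastr hc)).
by apply: path_connect_last (hc_pathr hc) _; rewrite inE zs orbT.
Qed.

(** The only child on the cycle is the successor on the same side. The two lists are shifted against
    each other by one, so that a common index [i] pairs a vertex with its successor. *)
Lemma chain_child z c : z \in ps -> c \in Z -> arc z c ->
  exists i, [/\ i <= size ps, z = nth d (a :: ps) i & c = nth d (rcons ps d) i].
Proof.
move=> zs cZ zc; have un := hc_uniq hc.
have zqs : z \notin a :: qs.
  move: un; rewrite /= mem_cat negb_or cat_uniq => /and3P[_ /andP[aps _] /and3P[_ /hasPn H _]].
  rewrite inE negb_or; apply/andP; split; first by apply: contraNneq aps => <-.
  by apply/negP=> /H; rewrite /= zs.
move: cZ; rewrite inE mem_cat => /or3P[/eqP ecd|cs|cs].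
- exists (size ps); rewrite nth_rcons ltnn eqxx; split=> //.
  rewrite ecd in zc; case/(hc_parents hc): zc => ez.
    by rewrite [LHS]ez (last_nth d).
  by rewrite ez mem_last in zqs.
- have ltc : index c ps < size ps by rewrite index_mem.
  exists (index c ps); rewrite nth_rcons ltc nth_index //; split=> //; first exact: ltnW.
  have nhc : ~~ hybrid arc c by apply: (cycle_chains_nonhybrid lev hc hd); rewrite mem_cat cs.
  apply: (nonhybrid_parent net nhc zc).
  by have /(pathP d)/(_ _ ltc) := hc_pathl hc; rewrite nth_index.
have nhc : ~~ hybrid arc c by apply: (cycle_chains_nonhybrid lev hc hd); rewrite mem_cat cs orbT.
have [u us uc] := path_pred (hc_pathr hc) cs.
by rewrite (nonhybrid_parent net nhc zc uc) us in zqs.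
Qed.

(** A side vertex is neither hybrid nor leaf, hence has two children, and [chain_child] allows only
    one of them on the cycle. *)
Lemma chain_hanging_child z : z \in ps -> exists2 c, arc z c & c \notin Z.
Proof.
move=> zs; have zZ : z \in Z by rewrite inE mem_cat zs orbT.
have zpq : z \in ps ++ qs by rewrite mem_cat zs.
have nhz := cycle_chains_nonhybrid lev hc hd zpq.
have nlz : ~~ leaf arc z.
  apply/negP=> lz; have ezd := leaf_connect lz (cycle_bottom zZ).
  by rewrite ezd hd in nhz.
have [c [c' [ncc zc zc']]] := outdeg_ge2 (nonhybrid_outdeg net nhz nlz).
have [cZ|cZ] := boolP (c \in Z); last by exists c.
have [c'Z|c'Z] := boolP (c' \in Z); last by exists c'.
have [i [li ez ec]] := chain_child zs cZ zc.
have [j [lj ez' ec']] := chain_child zs c'Z zc'.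
have ua : uniq (a :: ps).
  by have := hc_uniq hc; rewrite -cat_cons -cat1s uniq_catCA cat_uniq => /andP[].
suff eij : i = j by move: ncc; rewrite ec ec' eij eqxx.
by apply/eqP; rewrite -(nth_uniq d _ _ ua) ?ltnS // -ez -ez'.
Qed.

End HangingChild.

Section Gates.
Variables (d a : W) (ps qs : seq W).
Hypothesis hc : hybrid_cycle arc d a ps qs.
Hypothesis hd : hybrid arc d.
Local Notation Z := (d :: ps ++ qs).
Local Notation gate := (gate arc d ps qs).

(** Paths going down from [c] never return to the cycle, so every leaf below [c] has gate [z]. At
    [d], the lowest cycle vertex, [c] is [d] itself; elsewhere it is a child off the cycle. *)
Lemma cycle_hanging z : z \in Z ->
  exists2 c, gate z c & forall y, y \in Z -> anc c y -> y = c.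
Proof.
move=> zZ; have [ezd|nzd] := eqVneq z d.
  exists d; first by rewrite ezd; apply: gate_refl; apply: mem_head.
  by move=> y yZ dy; apply: (acyclic_antisym acy (cycle_bottom hc yZ) dy).
have [c zc cZ] : exists2 c, arc z c & c \notin Z.
  move: zZ; rewrite inE (negbTE nzd) mem_cat /= => /orP[zs|zs].
    exact: (chain_hanging_child hc hd zs).
  have [c zc cZ] := chain_hanging_child (hybrid_cycle_sym hc) hd zs.
  by exists c => //; move: cZ; rewrite !inE !mem_cat (orbC (c \in qs)).
exists c; first exact: gate_arc (gate_refl arc zZ) zc cZ.
move=> y yZ cy; case: (cycle_anc net lev hc hd yZ cy) => [|ca]; first by rewrite (negbTE cZ).
by case: (acyclic_arcF acy zc (connect_trans ca (cycle_top hc zZ))).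
Qed.

Lemma gate_leaf z : z \in Z -> exists x, gate z (f x).
Proof.
move=> zZ; have [c zc cmin] := cycle_hanging zZ.
have [w lw cw] := leaf_below c acy; have [x ex] := leafE lw.
exists x; rewrite ex; apply: (connect_invariant (P := gate z)) cw => // u y cu zu uy.
apply: (gate_arc zu uy); apply/negP=> yZ.
have eyc := cmin y yZ (connect_trans cu (connect1 uy)).
by rewrite eyc in uy; apply: acyclic_arcF uy cu.
Qed.

Lemma cycle_other z : exists2 z', z' \in Z & z != z'.
Proof.
have [i ispq] : exists i, i \in ps ++ qs.
  case: ps qs hc => [|x s]; last by exists x; rewrite mem_head.
  case=> [|y s'] hc'; last by exists y; rewrite mem_head.
  by have := hc_neq hc'; rewrite eqxx.
have nid : i != d.
  by apply: contraTneq ispq => ->; have /andP[+ _] := hc_uniq hc; rewrite inE negb_or => /andP[].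
have [->|nzd] := eqVneq z d; first by exists i; rewrite 1?eq_sym // inE ispq orbT.
by exists d; rewrite // mem_head.
Qed.

(** A vertex above both a gated and an ungated leaf has no gate itself, since gates are inherited
    downwards, so it is above [a]. Hence the gated leaves form a module, and it contains leaves with
    two different gates. *)
Lemma leaf_gated x : exists z, gate z (f x).
Proof.
pose M := [set y | has (fun z => gate z (f y)) Z].
have inM z y : gate z (f y) -> y \in M.
  by move=> zy; rewrite inE; apply/hasP; exists z => //; apply: gate_mem zy.
have mM : is_module adj M.
  apply: (explained_module (g := fun s w => anc w a && anc w (f s))) => y s w.
  rewrite inE => /hasP[z zZ zy] sM.
  have ng z' : gate z' w -> anc w (f s) -> False.
    by move=> z'w /(gate_down z'w)[z'' /inM]; apply/negP.
  apply/andP/andP=> -[wy ws]; split=> //; last first.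
    exact: connect_trans (connect_trans wy (cycle_top hc zZ)) (gate_connect zy).
  case: (gate_anc net lev hc hd zy wy) => [/ng/(_ ws)//|wz].
  by case: (cycle_anc net lev hc hd zZ wz) => // /(gate_refl arc)/ng/(_ ws).
have [y dy] := gate_leaf (mem_head d (ps ++ qs)).
have [z zZ ndz] := cycle_other d; have [y' zy'] := gate_leaf zZ.
have nyy : y != y'.
  apply: contraNneq ndz => eyy; rewrite -eyy in zy'.
  by rewrite (gate_inj net lev hc hd dy zy').
have : x \in M by rewrite (primitive_module mM (inM _ _ dy) (inM _ _ zy') nyy) inE.
by rewrite inE => /hasP[z' _ z'x]; exists z'.
Qed.

(** By [gate_common_anc] the leaves with gate [z] form a module. It misses the leaf of another gate,
    so primitivity leaves room for one element only. *)
Lemma gate_leaf_unique z x y : gate z (f x) -> gate z (f y) -> x = y.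
Proof.
move=> zx zy; apply/eqP; apply: contraT => nxy.
pose M := [set y | gate z (f y)].
have mM : is_module adj M.
  (* [explained_module] needs a function of [s], so a gate is chosen for every leaf. *)
  have g s : {z' | gate z' (f s)}.
    by apply: sigW; apply: leaf_gated.
  apply: (explained_module (g := fun s w => anc w z && anc w (sval (g s)))) => u s w.
  rewrite !inE => zu zs; case: (g s) => z' /= z's.
  apply: (gate_common_anc net lev hc hd) => //.
  by apply: contraNneq zs => ->.
have [z' z'Z nzz] := cycle_other z; have [y' z'y'] := gate_leaf z'Z.
have : y' \in M by rewrite (primitive_module mM _ _ nxy) ?inE.
by rewrite inE => /(gate_inj net lev hc hd z'y')/esym/eqP; rewrite (negbTE nzz).
Qed.

Lemma cycle_caterpillar_pair : exists v xs ys b, caterpillar_pair adj v xs ys b.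
Proof.
have [x0 _] := two_vertices.
pose lf z := odflt x0 [pick x | gate z (f x)].
have lfP z : z \in Z -> gate z (f (lf z)).
  by move=> /gate_leaf[x zx]; rewrite /lf; case: pickP => // /(_ x); rewrite zx.
have lf_inj : {in Z &, injective lf}.
  move=> z z' /lfP zz /lfP zz' e; rewrite e in zz; exact: (gate_inj net lev hc hd zz zz').
have adjE z z' : z \in Z -> z' \in Z -> z != z' ->
    adj (lf z) (lf z') <-> exists v, is_lca arc z z' v /\ t v = l1.
  move=> zZ z'Z nzz; have nll : lf z != lf z' by apply: contraNneq nzz => /lf_inj->.
  have [_ _ ex] := expl.
  have ce w := gate_common_anc net lev hc hd w (lfP _ zZ) (lfP _ z'Z) nzz.
  split=> [/ex|] H.
    have [|||v [lv tv]] := H; rewrite ?inE //.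
    by exists v; split=> //; apply: is_lca_ext lv.
  apply/ex; rewrite ?inE //; have [v [lv tv]] := H.
  by exists v; split=> //; apply: is_lca_ext lv => w; rewrite ce.
(* When [z] is above [z'] it is their lowest common ancestor, so [lf z] sees all leaves of lower
   cycle vertices alike, among them [lf d]. *)
have adj_anc z z' : z \in Z -> z' \in Z -> z != z' -> anc z z' ->
    adj (lf z) (lf z') <-> t z = l1.
  move=> zZ z'Z nzz zz; apply: iff_trans (adjE _ _ zZ z'Z nzz) _.
  exact: lca_greatest.
have un := hc_uniq hc.
have [uZ [ups uqs]] : uniq Z /\ uniq ps /\ uniq qs.
  move: un; rewrite /= cat_uniq inE negb_or => /and3P[/andP[_ ->] _].
  by case/and3P=> -> -> ->.
have nd z : z \in ps ++ qs -> z != d.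
  by move: uZ => /= /andP[dpq _]; apply: contraTneq => ->.
have dom s : path arc a s -> uniq s -> {subset s <= ps ++ qs} ->
    pairwise (fun x y => adj x y == adj x (lf d)) (map lf s).
  move=> pas us ss; rewrite pairwise_map.
  have sanc : pairwise anc s.
    rewrite -sorted_pairwise; last exact: connect_trans.
    by apply: (@path_sorted _ _ a); apply: sub_path pas => x y; apply: connect1.
  have : pairwise [rel x y | anc x y && (x != y)] s.
    by rewrite pairwise_relI sanc -uniq_pairwise.
  apply: (sub_in_pairwise (P := mem s)); last by apply/allP.
  move=> x y /ss x_s /ss y_s /= /andP[xy nxy].
  have [xZ yZ] : x \in Z /\ y \in Z by rewrite !inE x_s y_s !orbT.
  rewrite /=; apply/eqP; apply/idP/idP.
    by move/(adj_anc _ _ xZ yZ nxy xy)/(adj_anc _ _ xZ (mem_head _ _) (nd _ x_s) (cycle_bottom hc xZ)).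
  by move/(adj_anc _ _ xZ (mem_head _ _) (nd _ x_s) (cycle_bottom hc xZ))/(adj_anc _ _ xZ yZ nxy xy).
(* The apex is the leaf of the hybrid, the sides give the chains, and the label of the top decides
   adjacency across. *)
exists (lf d), (map lf ps), (map lf qs), (if t a is l1 then true else false); split.
- by rewrite -map_cat -map_cons map_inj_in_uniq.
- move=> x; rewrite -map_cat -map_cons; have [z zx] := leaf_gated x.
  have zZ := gate_mem zx; apply/mapP; exists z => //.
  exact: gate_leaf_unique zx (lfP _ zZ).
- by apply: dom (hc_pathl hc) ups _ => x xs; rewrite mem_cat xs.
- by apply: dom (hc_pathr hc) uqs _ => x xs; rewrite mem_cat xs orbT.
apply/allrelP=> _ _ /mapP[z zs ->] /mapP[z' z's ->].
have [zZ z'Z] : z \in Z /\ z' \in Z by rewrite !inE !mem_cat zs z's !orbT.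
have dis w : w \in ps -> w \in qs -> False.
  move: uZ; rewrite /= cat_uniq => /and4P[_ _ /hasPn H _] wp /H /=; by rewrite wp.
have nzz : z != z' by apply/eqP=> ezz; apply: (dis z); rewrite // ezz.
have nh w : w \in ps ++ qs -> ~~ hybrid arc w := cycle_chains_nonhybrid lev hc hd (x := w).
(* A common ancestor of vertices on opposite sides cannot lie on both sides, so [chain_anc] places
   it above [a]. *)
have e : adj (lf z) (lf z') <-> t a = l1.
  apply: iff_trans (adjE _ _ zZ z'Z nzz) _.
  apply: lca_greatest acy (cycle_top hc zZ) (cycle_top hc z'Z) _ => w wz wz'.
  have [|wp|//] := chain_anc net (hc_pathl hc) _ zs wz.
    by move=> x xs; apply: nh; rewrite mem_cat xs.
  have [|wq|//] := chain_anc net (hc_pathr hc) _ z's wz'.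
    by move=> x xs; apply: nh; rewrite mem_cat xs orbT.
  by case: (dis w).
apply/eqP; apply/idP/idP => [/e->//|]; case: (t a) e => // -[_ ->] //.
Qed.

End Gates.
End CycleLeaves.

(** * Polar pairs and primitivity *)

Definition alternating (b : bool) (s : seq bool) : bool := path (fun c d => c != d) b s.

(** Here [b] acts as the root label: both chains start with the opposite type and alternate from
    there. *)
Record polar_pair (T : finType) (adj : rel T) (v : T) (xs ys : seq T) (b : bool)
  : Prop := PolarPair {
  pp_pair :> caterpillar_pair adj v xs ys b;
  pp_left_neq : xs != [::];
  pp_right_neq : ys != [::];
  pp_left : alternating b [seq adj x v | x <- xs];
  pp_right : alternating b [seq adj y v | y <- ys] }.

Section Pairs.
Variables (T : finType) (adj : rel T).
Hypotheses (adj_irr : irreflexive adj) (adj_sym : symmetric adj).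
Implicit Types (v x y : T) (xs ys : seq T) (b : bool).

Lemma caterpillar_pair_sym v xs ys b :
  caterpillar_pair adj v xs ys b -> caterpillar_pair adj v ys xs b.
Proof.
have p : perm_eq (v :: ys ++ xs) (v :: xs ++ ys) by rewrite perm_cons perm_catC.
case=> un co le ri cr; split=> //; first by rewrite (perm_uniq p).
  by move=> x; rewrite (perm_mem p).
by apply/allrelP=> y x yy xx; rewrite adj_sym; apply: (allrelP cr).
Qed.

Lemma polar_pair_sym v xs ys b : polar_pair adj v xs ys b -> polar_pair adj v ys xs b.
Proof. by case=> /caterpillar_pair_sym. Qed.

Lemma primitive_no_dominating x b :
  primitive adj -> (forall y, y != x -> adj x y = b) -> False.
Proof.
move=> prim H.
have mM : is_module adj [set~ x].
  move=> y z s; rewrite !inE negbK => yx zx /eqP->.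
  by rewrite ![adj _ x]adj_sym !H.
have /card_gt1P[y [z [yM zM nyz]]] : 1 < #|[set~ x]| by rewrite cardsC1; case: prim; lia.
have : x \in [set~ x] by rewrite (primitive_module prim mM yM zM nyz) inE.
by rewrite !inE eqxx.
Qed.

Lemma primitive_no_twins x y :
  primitive adj -> x != y ->
  (forall s, s != x -> s != y -> adj x s = adj y s) -> False.
Proof.
move=> prim nxy H.
have mM : is_module adj [set x; y].
  move=> z w s zM wM; rewrite !inE negb_or => /andP[sx sy].
  have E u : u \in [set x; y] -> adj u s = adj x s.
    by rewrite !inE => /orP[]/eqP->; rewrite // H.
  by rewrite !E.
have e : [set x; y] = setT by apply: (primitive_module prim mM _ _ nxy); rewrite !inE eqxx ?orbT.
by have := prim.1; rewrite -cardsT -e cards2 nxy.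
Qed.

(** An empty chain, or a first vertex of type [b], yields a vertex that sees all others alike; equal
    consecutive types yield twins. *)
Lemma primitive_pair_left v xs ys b :
  primitive adj -> caterpillar_pair adj v xs ys b ->
  xs != [::] /\ alternating b [seq adj x v | x <- xs].
Proof.
move=> prim cp; have cov := cp_cover cp; split.
  apply/eqP=> exs; rewrite exs in cp cov.
  case: ys cp cov => [|y s] cp cov.
    apply: (primitive_no_dominating (x := v) (b := true) prim) => y.
    by have := cov y; rewrite inE => ->.
  apply: (primitive_no_dominating (x := y) (b := adj y v) prim) => z.
  have := cov z; rewrite !inE => /or3P[/eqP->|->|zs] // _.
  by have /= /andP[/allP/(_ z zs)/eqP] := cp_right cp.
(* Stated for suffixes of [xs], so that [last] supplies the type of the preceding vertex, or [b] at
   the start. *)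
suff H s1 s2 : xs = s1 ++ s2 ->
    path (fun c d => c != d) (last b [seq adj x v | x <- s1]) [seq adj x v | x <- s2].
  exact: (H [::] xs).
elim: s2 s1 => //= y s2 IH s1 exs.
have := IH (rcons s1 y); rewrite map_rcons last_rcons cat_rcons => -> //.
rewrite andbT; apply/eqP.
case/lastP: s1 exs {IH} => [|s1 x] exs /= eb.
  apply: (primitive_no_dominating (x := y) (b := b) prim) => z nzy.
  have := cov z; rewrite exs !inE mem_cat (negbTE nzy) /= => /or3P[/eqP->//|zs|zs].
    by have := cp_left cp; rewrite exs /= => /andP[/allP/(_ z zs)/eqP-> _].
  by apply/eqP; apply: (allrelP (cp_cross cp)); rewrite // exs mem_head.
rewrite map_rcons last_rcons cat_rcons in eb exs.
have := cp_left cp; rewrite exs pairwise_cat /= => /and3P[].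
move=> /allrelP up _ /andP[/andP[/eqP exy /allP xd] /andP[/allP yd _]].
have nxy : x != y.
  have := cp_uniq cp; rewrite cons_uniq cat_uniq => /and3P[_ + _].
  by rewrite exs cat_uniq => /and3P[_ _]; rewrite /= inE negb_or => /andP[/andP[]].
apply: (primitive_no_twins prim nxy) => z zx zy.
have := cov z; rewrite exs inE !mem_cat !inE (negbTE zx) (negbTE zy) /= => /orP[/eqP->//|].
case/orP => [/orP[zs|zs]|zs].
- rewrite ![adj _ z]adj_sym.
  have /eqP-> := up z x zs (mem_head _ _).
  by have /eqP-> := up z y zs (mem_behead (s := _ :: _) (mem_head _ _)).
- by rewrite (eqP (xd z zs)) (eqP (yd z zs)).
have cr u : u \in xs -> adj u z = b by move=> uxs; apply/eqP/(allrelP (cp_cross cp)).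
by rewrite !cr // exs mem_cat !inE eqxx !orbT.
Qed.

Lemma primitive_polar_pair v xs ys b :
  primitive adj -> caterpillar_pair adj v xs ys b -> polar_pair adj v xs ys b.
Proof.
move=> prim cp; have [l1 l2] := primitive_pair_left prim cp.
by have [r1 r2] := primitive_pair_left prim (caterpillar_pair_sym cp).
Qed.

Lemma module_inP (M : {set T}) x y z :
  is_module adj M -> x \in M -> y \in M -> adj x z != adj y z -> z \in M.
Proof. by move=> mM xM yM; apply: contraNT => zM; rewrite (mM x y z). Qed.

(** The vertex next to [x] is [u] or one on which [x] and [u] disagree, so it is in [M]. Two
    consecutive vertices disagree on everything below both, which pulls in the rest. *)
Lemma module_chain (M : {set T}) v x s u :
  is_module adj M -> pairwise (fun y z => adj y z == adj y v) (x :: s) ->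
  alternating (adj x v) [seq adj y v | y <- s] ->
  x \in M -> u \in rcons s v -> u \in M -> {subset rcons s v <= M}.
Proof.
move=> mM; case: s => [|w s] /=.
  by move=> _ _ _; rewrite !inE => /eqP-> vM z; rewrite inE => /eqP->.
move=> /andP[/andP[/eqP xw /allP xs] /andP[/allP ws _]] /andP[nxw _] xM us uM.
have below y (sy : {in s, forall z, adj y z == adj y v}) z : z \in rcons s v -> adj y z = adj y v.
  by rewrite mem_rcons inE => /orP[/eqP->|/sy/eqP].
have wM : w \in M.
  move: us; rewrite inE => /orP[/eqP<-//|us].
  by apply: (module_inP mM xM uM); rewrite xw (adj_sym u) (below w).
move=> z; rewrite inE => /orP[/eqP->//|zs].
by apply: (module_inP mM xM wM); rewrite !below.
Qed.

Lemma path_suffix (b : bool) v s1 x s2 :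
  alternating b [seq adj y v | y <- s1 ++ x :: s2] ->
  alternating (adj x v) [seq adj y v | y <- s2].
Proof. by rewrite /alternating map_cat cat_path /= => /and3P[]. Qed.

(** [x] and [v] disagree on the first vertex of [ys], whose type is not [b]. That vertex and [v]
    then absorb the chain by [module_chain]. *)
Lemma module_vertex_chain (M : {set T}) v xs ys b x :
  is_module adj M -> polar_pair adj v xs ys b ->
  v \in M -> x \in xs -> x \in M -> {subset ys <= M}.
Proof.
move=> mM pp vM xxs xM; case: ys pp => // y ys pp.
have /= /andP[nby alt] := pp_right pp.
have yM : y \in M.
  apply: (module_inP mM xM vM).
  have /eqP-> := allrelP (cp_cross pp) x y xxs (mem_head _ _).
  by rewrite (adj_sym v).
have := module_chain mM (cp_right pp) alt yM _ vM.
rewrite mem_rcons mem_head => /(_ isT) sub z; rewrite inE => /orP[/eqP->//|zs].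
by apply: sub; rewrite mem_rcons inE zs orbT.
Qed.

Lemma module_apex_full (M : {set T}) v xs ys b x :
  is_module adj M -> polar_pair adj v xs ys b ->
  v \in M -> x \in xs -> x \in M -> M = setT.
Proof.
move=> mM pp vM xxs xM; have sy := module_vertex_chain mM pp vM xxs xM.
have [y yys] : exists y, y \in ys by case: (ys) (pp_right_neq pp) => // y s; exists y; rewrite mem_head.
have sx := module_vertex_chain mM (polar_pair_sym pp) vM yys (sy y yys).
apply/setP=> z; rewrite inE; have := cp_cover pp z.
by rewrite inE mem_cat => /or3P[/eqP->|/sx|/sy].
Qed.

(** With two vertices of one chain, [module_chain] applied at the upper one brings [v] into [M], and
    [module_apex_full] finishes. *)
Lemma module_same_chain (M : {set T}) v xs ys b x y :
  is_module adj M -> polar_pair adj v xs ys b ->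
  x \in xs -> y \in v :: xs -> x != y -> x \in M -> y \in M -> M = setT.
Proof.
move=> mM pp xxs + nxy xM yM; rewrite inE => /orP[/eqP eyv|yxs].
  by apply: (module_apex_full mM pp _ xxs xM); rewrite -eyv.
apply: (module_apex_full mM pp _ xxs xM).
have key z w s1 s2 : xs = s1 ++ z :: s2 -> z \in M -> w \in s2 -> w \in M -> v \in M.
  move=> exs zM ws wM.
  have := pp_left pp; rewrite exs => /path_suffix alt.
  have := cp_left pp; rewrite exs pairwise_cat => /and3P[_ _ pw].
  apply: (module_chain mM pw alt zM _ wM); last by rewrite mem_rcons mem_head.
  by rewrite mem_rcons inE ws orbT.
have split (z : T) (s : seq T) : z \in s -> exists s1 s2, s = s1 ++ z :: s2.
  by case/splitPr=> s1 s2; exists s1, s2.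
have [s1 [s2 exs]] := split _ _ xxs; move: yxs.
rewrite exs mem_cat inE [y == x]eq_sym (negbTE nxy) /= => /orP[ys1|ys2]; last exact: (key x y s1 s2).
have [r1 [r2 es1]] := split _ _ ys1; rewrite es1 -catA /= in exs.
by apply: (key y x r1 _ exs) => //; rewrite mem_cat mem_head orbT.
Qed.

Lemma polar_pair_primitive v xs ys b :
  4 <= #|T| -> polar_pair adj v xs ys b -> primitive adj.
Proof.
move=> T4 pp; split=> // M mM.
have [|gt1] := leqP #|M| 1; first by rewrite leq_eqVlt ltnS leqn0 cards_eq0 => /orP[/eqP|/eqP]; auto.
right; left; case/card_gt1P: gt1 => x [y [xM yM nxy]].
have pp' := polar_pair_sym pp.
have same v' xs' ys' u w := @module_same_chain M v' xs' ys' b u w mM.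
(* A first vertex other than [u] sees [u] by its own type and [w] by [b], and these differ. *)
have top xs' ys' u w : polar_pair adj v xs' ys' b -> u \in xs' -> w \in ys' ->
    u \in M -> w \in M -> head v xs' \in M.
  case: xs' => //= z s pp1; have /= /andP[nbz _] := pp_left pp1.
  rewrite inE => /orP[/eqP->//|us] wys uM wM.
  apply: (module_inP mM uM wM); have /= /andP[/allP/(_ u us)/eqP zu _] := cp_left pp1.
  have /eqP zw := allrelP (cp_cross pp1) z w (mem_head _ _) wys.
  by rewrite ![adj _ z]adj_sym zu zw eq_sym.
have cross u w : u \in xs -> w \in ys -> u \in M -> w \in M -> M = setT.
  move=> uxs wys uM wM.
  have := top _ _ _ _ pp uxs wys uM wM; have := top _ _ _ _ pp' wys uxs wM uM.
  (* The two first vertices disagree on the second vertex of [xs'], which reduces to two vertices in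
     the same chain. *)
  have long xs' ys' : polar_pair adj v xs' ys' b -> 1 < size xs' -> 0 < size ys' ->
      head v ys' \in M -> head v xs' \in M -> M = setT.
    case: xs' => // x1 [//|x2 s]; case: ys' => //= y1 s' pp1 _ _ y1M x1M.
    have nx : x1 != x2.
      have := cp_uniq pp1; rewrite !cons_uniq => /and3P[_ + _].
      by rewrite /= inE negb_or => /andP[].
    apply: (same _ _ _ x1 x2 pp1); rewrite ?inE ?eqxx ?orbT //.
    apply: (module_inP mM x1M y1M).
    have /= /andP[/andP[/eqP-> _] _] := cp_left pp1.
    have /eqP := allrelP (cp_cross pp1) x2 y1 (mem_behead (s := _ :: _) (mem_head _ _)) (mem_head _ _).
    rewrite (adj_sym y1) => ->.
    by have /= /andP[] := pp_left pp1; rewrite eq_sym.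
  have sz : size (v :: xs ++ ys) = #|T|.
    rewrite -(card_uniqP (cp_uniq pp)); apply: eq_card => z.
    by rewrite (cp_cover pp).
  (* At least three vertices besides [v] are spread over the two chains, so one chain has length at
     least two. *)
  have [sx|sx] := ltnP 1 (size xs).
    by move=> y1 x1; apply: (long _ _ pp) => //; case: (ys) wys.
  move=> y1 x1; apply: (long _ _ pp') => //; last by case: (xs) uxs.
  by move: sz T4; rewrite /= size_cat => <-; lia.
have := cp_cover pp x; have := cp_cover pp y; rewrite !inE !mem_cat.
case/or3P=> [/eqP yv|yx|yy] /or3P[/eqP xv|xx|xy]; subst.
- by rewrite eqxx in nxy.
- by apply: (same _ _ _ x v pp); rewrite ?mem_head.
- by apply: (same _ _ _ x v pp'); rewrite ?mem_head.
- by apply: (same _ _ _ y v pp); rewrite ?mem_head 1?eq_sym.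
- by apply: (same _ _ _ x y pp); rewrite // inE yx orbT.
- exact: (cross y x).
- by apply: (same _ _ _ y v pp'); rewrite ?mem_head 1?eq_sym.
- exact: (cross x y).
by apply: (same _ _ _ x y pp'); rewrite // inE yy orbT.
Qed.

End Pairs.

Section Degrees.
Variables (W : finType) (arc : rel W).

Lemma indeg_eq0 w : (forall u, ~~ arc u w) -> indeg arc w = 0.
Proof.
by move=> H; apply/eqP; rewrite cards_eq0; apply/eqP/setP=> u; rewrite !inE (negbTE (H u)).
Qed.

Lemma indeg_eq1 w u : arc u w -> (forall u', arc u' w -> u' = u) -> indeg arc w = 1.
Proof.
move=> uw H; apply/eqP/cards1P; exists u; apply/setP=> u'; rewrite !inE.
by apply/idP/eqP=> [/H|->].
Qed.

Lemma indeg_eq2 w u u' : u != u' -> arc u w -> arc u' w ->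
  (forall x, arc x w -> x = u \/ x = u') -> indeg arc w = 2.
Proof.
move=> ne uw u'w H; apply/eqP/cards2P; exists u, u'; split=> //; apply/setP=> x; rewrite !inE.
by apply/idP/orP=> [/H[->|->]|[/eqP->|/eqP->]] //; rewrite eqxx; [left|right].
Qed.

Lemma outdeg_eq2 w u u' : u != u' -> arc w u -> arc w u' ->
  (forall x, arc w x -> x = u \/ x = u') -> outdeg arc w = 2.
Proof.
move=> ne uw u'w H; apply/eqP/cards2P; exists u, u'; split=> //; apply/setP=> x; rewrite !inE.
by apply/idP/orP=> [/H[->|->]|[/eqP->|/eqP->]] //; rewrite eqxx; [left|right].
Qed.

Lemma is_lca_sym x y z : is_lca arc x y z -> is_lca arc y x z.
Proof. by apply: is_lca_ext => w; rewrite andbC. Qed.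

End Degrees.

(** One half of a polar pair: the chain from the root to the cherry of [v], with the type of its
    first vertex left free. *)
Record caterpillar_order (T : finType) (adj : rel T) (A : {set T}) (v : T) (xs : seq T)
  : Prop := CaterpillarOrder {
  co_uniq : uniq (v :: xs);
  co_mem : A =i v :: xs;
  co_neq : xs != [::];
  co_dom : pairwise (fun x y => adj x y == adj x v) xs;
  co_alt : sorted (fun c d => c != d) [seq adj x v | x <- xs] }.

(** * Caterpillars *)

Section Orders.
Variables (T : finType) (adj : rel T).
Hypotheses (adj_irr : irreflexive adj) (adj_sym : symmetric adj).
Implicit Types (A : {set T}) (v x y : T) (xs s : seq T).

(** The top vertex is adjacent to all the others or to none: it is a hub in one case and isolated in
    the other. *)
Lemma order_connected A v x s :
  caterpillar_order adj A v (x :: s) -> (connected_in adj A <-> adj x v).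
Proof.
case=> un eA _ /= /andP[/allP xd _] _.
have below y : y \in A -> y != x -> adj x y = adj x v.
  rewrite eA !inE => + nyx; rewrite (negbTE nyx) => /orP[/eqP->//|/= /xd/eqP->//].
have xA : x \in A by rewrite eA !inE eqxx orbT.
have vA : v \in A by rewrite eA mem_head.
split=> [cA|xv].
  case/connect_first_step: (cA x v xA vA) => [exv|[c /and3P[_ cA' xc] _]].
    by move: un; rewrite exv /= mem_head.
  rewrite -(below c) //; apply: contraTneq xc => ->; by rewrite adj_irr.
set e := [rel u w | [&& u \in A, w \in A & adj u w]].
have e_sym : connect_sym e.
  by apply: sym_connect_sym => u w /=; rewrite andbCA adj_sym.
have ex y : y \in A -> connect e x y.
  move=> yA; have [->//|nyx] := eqVneq y x.
  by apply: connect1; rewrite /= xA yA below.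
move=> y z yA zA; apply: (@connect_trans _ _ x); last exact: ex.
by rewrite e_sym ex.
Qed.

(* The topmost vertex of a P4 would be adjacent to all or to none of the other three. *)
Lemma order_cograph A v xs : caterpillar_order adj A v xs -> cograph_on adj A.
Proof.
case=> _ eA _ dom _ [a [b [c [d [[]]]]]]; rewrite !eA {A eA} => av bv cv dv.
rewrite /= !inE !negb_or => -[/and4P[/and3P[ab ac ad] /andP[bc bd] cd _]].
case=> -[eab ebc ecd] [nac nbd nad].
elim: xs dom av bv cv dv => [_|x s IH] /=.
  by rewrite !inE => /eqP ea /eqP eb; rewrite ea eb eqxx in ab.
move=> /andP[/allP xd dom].
have E y z : y \in v :: x :: s -> z \in v :: x :: s -> x != y -> x != z -> adj x y = adj x z.
  have below u : u \in v :: x :: s -> x != u -> adj x u = adj x v.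
    rewrite !inE => + nxu; rewrite eq_sym in nxu.
    by rewrite (negbTE nxu) => /orP[/eqP->//|/xd/eqP].
  by move=> ? ? ? ?; rewrite !below.
move=> av bv cv dv.
have [xa|xa] := eqVneq x a.
  by have := E b c bv cv; rewrite xa => /(_ ab ac); rewrite eab (negbTE nac).
have [xb|xb] := eqVneq x b.
  have := E a d av dv; rewrite xb => /(_ _ bd); rewrite eq_sym => /(_ ab).
  by rewrite (adj_sym b) eab (negbTE nbd).
have [xc|xc] := eqVneq x c.
  have := E d a dv av; rewrite xc => /(_ cd); rewrite eq_sym => /(_ ac).
  by rewrite ecd adj_sym (negbTE nac).
have [xd'|xd'] := eqVneq x d.
  have := E c a cv av; rewrite xd' ![d == _]eq_sym => /(_ cd ad).
  by rewrite ![adj d _]adj_sym ecd (negbTE nad).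
move: av bv cv dv; rewrite !inE ![_ == x]eq_sym.
by rewrite (negbTE xa) (negbTE xb) (negbTE xc) (negbTE xd'); apply: IH.
Qed.

Definition lab_of (b : bool) : lab := if b then l1 else l0.

Lemma lab_ofE b : lab_of b = l1 <-> b. Proof. by case: b. Qed.

Lemma lab_of_inj b c : lab_of b = lab_of c -> b = c. Proof. by case: b c => -[]. Qed.

Section Caterpillar.
Variables (A : {set T}) (v : T) (xs : seq T).
Hypothesis co : caterpillar_order adj A v xs.
Local Notation k := (size xs).
Local Notation W := 'I_(k.*2.+1).

(* The spine is [0, ..., k], whose end [k] is the leaf of [v]; the leaf of the
   [i]-th vertex of [xs] is [k + 1 + i]. *)
Definition cat_arc : rel W := fun i j => (i < k) && ((j == i.+1 :> nat) || (j == k.+1 + i :> nat)).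
Definition cat_lab (i : W) : lab := if i < k then lab_of (adj (nth v xs i) v) else lodot.
Definition cat_leaf (x : T) : W := inord (if x == v then k else k.+1 + index x xs).

Let k_gt0 : 0 < k. Proof. by case: xs (co_neq co). Qed.

Let index_lt x : x \in xs -> index x xs < k.
Proof. by rewrite index_mem. Qed.

Let val_leaf x : x \in A -> cat_leaf x = (if x == v then k else k.+1 + index x xs) :> nat.
Proof.
rewrite (co_mem co) inE => xA; rewrite inordK //; case: eqP xA => [_ _|_ /=]; first by lia.
by move=> /index_lt; lia.
Qed.

Let arcE (i j : W) : cat_arc i j = (i < k) && ((j == i.+1 :> nat) || (j == k.+1 + i :> nat)).
Proof. by []. Qed.

Let valI (i : nat) : i < k.*2.+1 -> (inord i : W) = i :> nat.
Proof. exact: inordK. Qed.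

Lemma cat_leafE i : leaf cat_arc i = (k <= i).
Proof.
apply/idP/idP=> [li|ki].
  rewrite leqNgt; apply/negP=> ik; apply: (leaf_arcF li (c := inord i.+1)).
  by rewrite arcE valI ?eqxx ?ik //; lia.
apply/negPn/negP=> /leafPn[c]; rewrite arcE; lia.
Qed.

Lemma cat_outdeg (i : W) : i < k -> outdeg cat_arc i = 2.
Proof.
move=> ik; apply: (@outdeg_eq2 _ _ _ (inord i.+1) (inord (k.+1 + i))).
- by rewrite -val_eqE /= !valI; lia.
- by rewrite arcE valI; lia.
- by rewrite arcE valI; lia.
move=> j; rewrite arcE => /andP[_ /orP[]/eqP ej]; [left|right]; apply: ord_inj; rewrite valI //; lia.
Qed.

Lemma cat_parent (u u' w : W) : cat_arc u w -> cat_arc u' w -> u' = u.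
Proof. rewrite !arcE => uw u'w; apply: ord_inj; have := ltn_ord w; lia. Qed.

Lemma cat_indeg (i : W) : 0 < i -> indeg cat_arc i = 1.
Proof.
move=> i0; have [ik|ik] := leqP i k.
  apply: (@indeg_eq1 _ _ _ (inord i.-1)); first by rewrite arcE valI; have := ltn_ord i; lia.
  by move=> u; apply: cat_parent; rewrite arcE valI; have := ltn_ord i; lia.
apply: (@indeg_eq1 _ _ _ (inord (i - k.+1))); first by rewrite arcE valI; have := ltn_ord i; lia.
by move=> u; apply: cat_parent; rewrite arcE valI; have := ltn_ord i; lia.
Qed.

Lemma cat_root : indeg cat_arc ord0 = 0.
Proof. by apply: indeg_eq0 => u; rewrite arcE /=; lia. Qed.

Lemma cat_acyclic : acyclic cat_arc.
Proof. apply: (acyclic_ranked (rk := val)) => i j; rewrite arcE /=; lia. Qed.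

Lemma cat_network : is_network cat_arc.
Proof.
split; first exact: cat_acyclic.
right; exists ord0; split; [exact: cat_root | by rewrite cat_outdeg |].
move=> i ni; have i0 : 0 < i by rewrite lt0n.
have [ki|ik] := leqP k i.
  by constructor 1; split; [apply/eqP; rewrite -/(leaf _ _) cat_leafE | exact: cat_indeg].
by constructor 2; rewrite cat_indeg ?cat_outdeg.
Qed.

Lemma cat_spine (i j : W) : i <= j -> j <= k -> connect cat_arc i j.
Proof.
move=> ij jk; have [n en] : exists n, j = i + n :> nat by exists (j - i); lia.
elim: n j ij jk en => [|n IH] j ij jk en.
  by rewrite (_ : j = i) //; apply: ord_inj; lia.
apply: (@connect_trans _ _ (inord j.-1)); first by apply: IH; rewrite valI; lia.
by apply: connect1; rewrite arcE valI; lia.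
Qed.

Lemma cat_explains : explains_on adj cat_arc A cat_lab cat_leaf.
Proof.
have eA := co_mem co; have un := co_uniq co.
(* As [v] is not in [xs], its index is [k], so it counts as the last position of the chain. *)
have pos x : x \in A -> index x xs <= k /\ (x == v = (index x xs == k)).
  rewrite eA inE index_size => xA; split=> //.
  case: eqP xA => [->_|_ /=]; last by move=> /index_lt; lia.
  by rewrite memNindex ?eqxx //; case/andP: un.
have fE x : x \in A -> cat_leaf x = (if index x xs == k then k else k.+1 + index x xs) :> nat.
  by move=> xA; rewrite val_leaf // -(pos x xA).2.
have nthx x : x \in A -> nth v xs (index x xs) = x.
  move=> xA; have [_ exv] := pos x xA; case: (eqVneq x v) exv => [-> /esym/eqP->|nxv _].
    by rewrite nth_default.
  by rewrite nth_index //; move: xA; rewrite eA inE (negbTE nxv).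
have inj : {in A &, injective cat_leaf}.
  move=> x y xA yA /(congr1 val) /=; rewrite !fE // => e.
  rewrite -(nthx x) // -(nthx y) //; congr nth; move: e.
  have [+ _] := pos x xA; have [+ _] := pos y yA; case: eqP; case: eqP; lia.
split=> // [w|x y xA yA nxy].
  rewrite cat_leafE; split=> [kw|[x xA <-]]; last by rewrite fE //; case: eqP; lia.
  have lw := ltn_ord w.
  have [ewk|nwk] := eqVneq (w : nat) k.
    have vA : v \in A by rewrite eA mem_head.
    exists v => //; apply: ord_inj; rewrite val_leaf // eqxx; lia.
  have ltw : w - k.+1 < k by lia.
  have wxs : nth v xs (w - k.+1) \in xs by apply: mem_nth.
  exists (nth v xs (w - k.+1)); first by rewrite eA inE wxs orbT.
  apply: ord_inj; rewrite fE ?eA ?inE ?wxs ?orbT // index_uniq //; last by case/andP: un.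
  by rewrite ltn_eqF //; lia.
wlog lt_xy : x y xA yA nxy / index x xs < index y xs.
  move=> H; case: (ltngtP (index x xs) (index y xs)) => [|lt|e]; first exact: H.
    rewrite adj_sym; rewrite eq_sym in nxy; apply: iff_trans (H y x yA xA nxy lt) _.
    by split=> -[z [lz tz]]; exists z; split=> //; apply: is_lca_sym.
  by case/eqP: nxy; rewrite -(nthx x) // -(nthx y) // e.
have [yk _] := pos y yA.
have ltxk : index x xs < k by lia.
have -> : adj x y = adj x v.
  have xxs : x \in xs by rewrite -index_mem.
  have [->//|nyv] := eqVneq y v.
  have yxs : y \in xs by move: yA; rewrite eA inE (negbTE nyv).
  have /(pairwiseP v) dom := co_dom co.
  have := dom (index x xs) (index y xs); rewrite !inE !index_mem => /(_ xxs yxs lt_xy).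
  by rewrite !nthx // => /eqP.
(* The parent of the leaf of [x]; it is the lowest common ancestor because [y] comes later in the
   chain. *)
set m : W := inord (index x xs).
have em : m = index x xs :> nat by apply: valI; lia.
have mx : cat_arc m (cat_leaf x) by rewrite arcE fE // em (ltn_eqF ltxk) ltxk eqxx orbT.
have my : connect cat_arc m (cat_leaf y).
  have lty := ltn_ord (cat_leaf y).
  case: (eqVneq (index y xs) k) => [eyk|nyk].
    by apply: cat_spine; rewrite fE // eyk eqxx // em; lia.
  apply: (@connect_trans _ _ (inord (index y xs))); first by apply: cat_spine; rewrite valI ?em; lia.
  by apply: connect1; rewrite arcE fE // !ifN // valI ?eqxx ?orbT ?andbT; lia.
have lx : leaf cat_arc (cat_leaf x) by rewrite cat_leafE fE //; case: eqP; lia.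
apply: iff_sym; apply: iff_trans.
  apply: (lca_greatest (m := m) _ cat_acyclic (connect1 mx) my) => w wx wy.
  case/connect_last_step: wx => [ewx|[p wp px]]; last by rewrite (cat_parent px mx).
  rewrite ewx in wy; have /inj := leaf_connect lx wy.
  by move=> /(_ xA yA) exy; rewrite exy eqxx in nxy.
by rewrite /cat_lab em ltxk nthx // lab_ofE.
Qed.

Lemma order_caterpillar : caterpillar_cherry adj A v.
Proof.
exists k.*2.+1, cat_arc, cat_lab, cat_leaf; split; [split|split].
- split=> [|i]; first exact: cat_network.
  have [i0|i0] := posnP i; last by rewrite cat_indeg.
  by rewrite (_ : i = ord0) ?cat_root //; apply: ord_inj.
- move=> i; rewrite cat_leafE /cat_lab; case: ltnP => //= _.
  by case: (adj _ _).
- move=> i j; rewrite !cat_leafE -!ltnNge arcE => /andP[_ /orP[]/eqP ej] ik jk; last by lia.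
  rewrite /cat_lab ik jk => /lab_of_inj.
  have /(sortedP true)/(_ i) := co_alt co; rewrite size_map ej in jk *.
  by rewrite !(nth_map v) // => /(_ jk)/eqP.
- split=> [i|]; first by rewrite cat_leafE -ltnNge; exact: cat_outdeg.
  exists ord0, [seq inord i | i <- iota 1 k.-1].
  have e : ord0 :: [seq (inord i : W) | i <- iota 1 k.-1] = [seq inord i | i <- iota 0 k].
    have -> : iota 0 k = 0 :: iota 1 k.-1 by case: (k) k_gt0.
    by congr cons; apply: ord_inj; rewrite valI.
  rewrite e; split.
  + exact: cat_root.
  + rewrite map_inj_in_uniq ?iota_uniq // => i j; rewrite !mem_iota => ik jk /(congr1 val) /=.
    by rewrite !valI; lia.
  + move=> w; rewrite cat_leafE -ltnNge; apply/mapP/idP=> [[i]|wk].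
      by rewrite mem_iota => ik ->; rewrite valI; lia.
    by exists (w : nat); rewrite ?mem_iota //; apply: ord_inj; rewrite valI.
  move=> i j; rewrite size_map size_iota => ik jk.
  rewrite !(nth_map 0) ?size_iota // !nth_iota // /und !arcE !valI; lia.
- exact: cat_explains.
have vA : v \in A by rewrite (co_mem co) mem_head.
(* The last inner vertex [k - 1] has as children the leaf [k] of [v] and the leaf
   [k + 1 + (k - 1) = 2k]. *)
exists (inord k.-1), (inord k.*2); rewrite !cat_leafE !arcE -val_eqE /= !valI ?val_leaf ?eqxx //; try lia.
by split; lia.
Qed.

End Caterpillar.
End Orders.

(** * The network of a polar pair *)

Section CycleNetwork.
Variables (k l : nat).
Hypotheses (k_gt0 : 0 < k) (l_gt0 : 0 < l).
Local Notation m := (k + l).+1.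
Local Notation W := 'I_(m.*2.+1).

(* A single cycle: the root [0], two chains [1, ..., k] and [k + 1, ..., k + l],
   and the hybrid [m = k + l + 1]; a leaf [m + i] hangs from each [i] in [1, ..., m]. *)
Definition cyc_arc : rel W := fun i j =>
  [|| (i == 0 :> nat) && ((j == 1 :> nat) || (j == k.+1 :> nat)),
      (0 < i <= m) && (j == m + i :> nat), (0 < i < k) && (j == i.+1 :> nat),
      (i == k :> nat) && (j == m :> nat) | (k < i < m) && (j == i.+1 :> nat)].

Let arcE (i j : W) : cyc_arc i j = [|| (i == 0 :> nat) && ((j == 1 :> nat) || (j == k.+1 :> nat)),
      (0 < i <= m) && (j == m + i :> nat), (0 < i < k) && (j == i.+1 :> nat),
      (i == k :> nat) && (j == m :> nat) | (k < i < m) && (j == i.+1 :> nat)].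
Proof. by []. Qed.

Let valI (i : nat) : i < m.*2.+1 -> (inord i : W) = i :> nat.
Proof. exact: inordK. Qed.

Lemma cyc_acyclic : acyclic cyc_arc.
Proof. apply: (acyclic_ranked (rk := val)) => i j; rewrite arcE /=; lia. Qed.

Lemma cyc_pendant (i : W) : 0 < i -> i <= m -> cyc_arc i (inord (m + i)).
Proof. by move=> i0 im; rewrite arcE valI; lia. Qed.

Lemma cyc_leafE (i : W) : leaf cyc_arc i = (m < i).
Proof.
apply/idP/idP=> [li|mi].
  rewrite ltnNge; apply/negP=> im; apply: (leaf_arcF li (c := inord (if i == 0 :> nat then 1 else m + i))).
  by rewrite arcE valI; case: eqP; lia.
apply/negPn/negP=> /leafPn[c]; rewrite arcE; lia.
Qed.

Lemma cyc_indeg0 : indeg cyc_arc ord0 = 0.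
Proof. by apply: indeg_eq0 => u; rewrite arcE /=; lia. Qed.

Lemma cyc_indeg_m (i : W) : i = m :> nat -> indeg cyc_arc i = 2.
Proof.
move=> im; apply: (@indeg_eq2 _ _ _ (inord k) (inord (k + l))).
- by rewrite -val_eqE /= !valI; lia.
- by rewrite arcE valI; lia.
- by rewrite arcE valI; lia.
move=> u; rewrite arcE => ui.
have [uk|uk] : u = k :> nat \/ u = k + l :> nat by lia.
  by left; apply: ord_inj; rewrite uk valI //; lia.
by right; apply: ord_inj; rewrite uk valI //; lia.
Qed.

Lemma cyc_parent (u u' i : W) : i != m :> nat -> cyc_arc u i -> cyc_arc u' i -> u' = u.
Proof. by rewrite !arcE => im ui u'i; apply: ord_inj; lia. Qed.

Lemma cyc_indeg1 (i : W) : 0 < i -> i != m :> nat -> indeg cyc_arc i = 1.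
Proof.
move=> i0 im; have lti := ltn_ord i.
have [u ui] : exists u, cyc_arc u i.
  have [mi|mi] := ltnP m i; first by exists (inord (i - m)); rewrite arcE valI; lia.
  have [i1|i1] := boolP ((i == 1 :> nat) || (i == k.+1 :> nat)).
    by exists ord0; rewrite arcE /=; lia.
  by exists (inord i.-1); rewrite arcE valI; lia.
by apply: (indeg_eq1 ui) => u'; apply: cyc_parent.
Qed.

Lemma cyc_outdeg (i : W) : i < m -> outdeg cyc_arc i = 2.
Proof.
move=> im; have [i0|i0] := posnP i.
  apply: (@outdeg_eq2 _ _ _ (inord 1) (inord k.+1)).
  - by rewrite -val_eqE /= !valI; lia.
  - by rewrite arcE valI; lia.
  - by rewrite arcE valI; lia.
  move=> u; rewrite arcE => ui.
  have [uk|uk] : u = 1 :> nat \/ u = k.+1 :> nat by lia.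
    by left; apply: ord_inj; rewrite uk valI //; lia.
  by right; apply: ord_inj; rewrite uk valI //; lia.
(* The successor on the cycle: the end [k] of the left chain jumps to the hybrid, since [k + 1]
   starts the right chain. *)
pose s := if i == k :> nat then m else i.+1.
have es : (i == k :> nat) && (s == m) || (i != k :> nat) && (s == i.+1).
  by rewrite /s; case: eqP => _; rewrite eqxx.
clearbody s.
apply: (@outdeg_eq2 _ _ _ (inord (m + i)) (inord s)).
- by rewrite -val_eqE /= !valI; lia.
- by apply: cyc_pendant; lia.
- by rewrite arcE valI; lia.
move=> u; rewrite arcE => ui.
have [uk|uk] : u = m + i :> nat \/ u = s :> nat by lia.
  by left; apply: ord_inj; rewrite uk valI //; lia.
by right; apply: ord_inj; rewrite uk valI //; lia.
Qed.

Lemma cyc_network : is_network cyc_arc.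
Proof.
split; first exact: cyc_acyclic.
right; exists ord0; split; [exact: cyc_indeg0 | by rewrite cyc_outdeg |].
move=> i ni; have i0 : 0 < i by rewrite lt0n.
have [im|im|im] := ltngtP i m.
- by constructor 2; rewrite cyc_indeg1 ?cyc_outdeg // ltn_eqF.
- constructor 1; split; first by apply/eqP; rewrite -/(leaf _ _) cyc_leafE.
  by rewrite cyc_indeg1 // gtn_eqF.
constructor 3; rewrite cyc_indeg_m //; split=> //.
by rewrite lt0n -/(leaf _ _) cyc_leafE im ltnn.
Qed.

(** The whole network has a single hybrid, so the shape of the blocks does not matter. *)
Lemma cyc_level1 : level1 cyc_arc.
Proof.
move=> S _; rewrite leqNgt; apply/negP=> /card_gt1P[h [h' []]]; rewrite !inE.
have hyb i : hybrid cyc_arc i -> i = m :> nat.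
  rewrite /hybrid => /eqP hi; apply/eqP/negPn/negP=> im.
  have [i0|i0] := posnP i; last by rewrite cyc_indeg1 in hi.
  by move: hi; rewrite (_ : i = ord0) ?cyc_indeg0 //; apply: ord_inj.
by move=> /andP[_ /hyb em] /andP[_ /hyb em'] /eqP[]; apply: ord_inj; rewrite em.
Qed.

Lemma cyc_chain_left (i j : W) : 0 < i -> i <= j -> j <= k -> connect cyc_arc i j.
Proof.
move=> i0 ij jk; have [n en] : exists n, j = i + n :> nat by exists (j - i); lia.
elim: n j ij jk en => [|n IH] j ij jk en.
  by rewrite (_ : j = i) //; apply: ord_inj; lia.
apply: (@connect_trans _ _ (inord j.-1)); first by apply: IH; rewrite valI; lia.
by apply: connect1; rewrite arcE valI; lia.
Qed.

Lemma cyc_chain_right (i j : W) : k < i -> i <= j -> j <= m -> connect cyc_arc i j.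
Proof.
move=> i0 ij jk; have [n en] : exists n, j = i + n :> nat by exists (j - i); lia.
elim: n j ij jk en => [|n IH] j ij jk en.
  by rewrite (_ : j = i) //; apply: ord_inj; lia.
apply: (@connect_trans _ _ (inord j.-1)); first by apply: IH; rewrite valI; lia.
by apply: connect1; rewrite arcE valI; lia.
Qed.

Lemma cyc_to_hybrid (i j : W) : 0 < i -> i <= m -> j = m :> nat -> connect cyc_arc i j.
Proof.
move=> i0 im jm; have [ki|ik] := ltnP k i; first by apply: cyc_chain_right; lia.
apply: (@connect_trans _ _ (inord k)); first by apply: cyc_chain_left; rewrite ?valI; lia.
by apply: connect1; rewrite arcE valI; lia.
Qed.

Lemma cyc_root_connect (i : W) : i < m -> connect cyc_arc ord0 i.
Proof.
move=> im; have [i0|i0] := posnP i.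
  by rewrite (_ : i = ord0) //; apply: ord_inj.
have [ki|ik] := ltnP k i.
  apply: (@connect_trans _ _ (inord k.+1)); first by apply: connect1; rewrite arcE valI /=; lia.
  by apply: cyc_chain_right; rewrite ?valI; lia.
apply: (@connect_trans _ _ (inord 1)); first by apply: connect1; rewrite arcE valI /=; lia.
by apply: cyc_chain_left; rewrite ?valI; lia.
Qed.

Lemma cyc_sides_anc (w i j : W) : i <= k -> k < j -> j < m ->
  connect cyc_arc w i -> connect cyc_arc w j -> w = ord0.
Proof.
move=> ik kj jm wi wj; apply: ord_inj => /=.
(* From the left chain one reaches only that chain and numbers from [m] on; from a number above [k],
   only numbers above [k]. So neither kind of vertex is above both [i] and [j]. *)
have inv u : connect cyc_arc w u ->
    ((0 < w <= k) ==> (0 < u <= k) || (m <= u)) && ((k < w) ==> (k < u)).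
  apply: (connect_invariant (P := fun u : W =>
    ((0 < w <= k) ==> (0 < u <= k) || (m <= u)) && ((k < w) ==> (k < u)))); first lia.
  by move=> x y _ H; rewrite arcE => xy; lia.
have := inv i wi; have := inv j wj; lia.
Qed.

End CycleNetwork.

Section PolarNetwork.
Variables (T : finType) (adj : rel T).
Hypothesis adj_sym : symmetric adj.
Variables (v : T) (xs ys : seq T) (b : bool).
Hypothesis pp : polar_pair adj v xs ys b.
Local Notation k := (size xs).
Local Notation l := (size ys).
Local Notation m := (k + l).+1.
Local Notation W := 'I_(m.*2.+1).
Local Notation arc := (@cyc_arc k l).

Let k_gt0 : 0 < k. Proof. by case: xs (pp_left_neq pp). Qed.
Let l_gt0 : 0 < l. Proof. by case: ys (pp_right_neq pp). Qed.

(* [index v (xs ++ ys)] is [k + l], so [v] becomes the leaf below the hybrid. *)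
Definition cyc_leaf (x : T) : W := inord (m + (index x (xs ++ ys)).+1).
Definition cyc_inner (x : T) : W := inord (index x (xs ++ ys)).+1.
Definition cyc_lab (i : W) : lab :=
  if i == 0 :> nat then lab_of b
  else if i <= m then lab_of (adj (nth v (xs ++ ys) i.-1) v) else lodot.

Let index_le x : index x (xs ++ ys) <= k + l.
Proof. by rewrite -size_cat index_size. Qed.

Lemma cyc_innerE x : cyc_inner x = (index x (xs ++ ys)).+1 :> nat.
Proof. by rewrite inordK //; have := index_le x; lia. Qed.

Lemma cyc_leaf_val x : cyc_leaf x = m + (index x (xs ++ ys)).+1 :> nat.
Proof. by rewrite inordK //; have := index_le x; lia. Qed.

Let vnotin : v \notin xs ++ ys. Proof. by have /andP[] := cp_uniq pp. Qed.

Lemma nth_indexv x : nth v (xs ++ ys) (index x (xs ++ ys)) = x.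
Proof.
have := cp_cover pp x; rewrite inE => /orP[/eqP->|]; last exact: nth_index.
by rewrite memNindex // nth_default.
Qed.

Lemma cyc_leaf_arc x : arc (cyc_inner x) (cyc_leaf x).
Proof.
have := @cyc_pendant k l k_gt0 l_gt0 (cyc_inner x); rewrite cyc_innerE => H.
by apply: H; have := index_le x; lia.
Qed.

Lemma cyc_leaf_leaf x : leaf arc (cyc_leaf x).
Proof. by rewrite cyc_leafE // cyc_leaf_val; lia. Qed.

Lemma cyc_leaf_inj : injective cyc_leaf.
Proof.
move=> x y /(congr1 val) /=; rewrite !cyc_leaf_val => e.
rewrite -(nth_indexv x) -(nth_indexv y); congr nth; lia.
Qed.

(** A common ancestor of two leaves is not one of them, so each path to a leaf passes through its
    unique parent on the cycle. *)
Lemma cyc_common_anc w x y : x != y ->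
  connect arc w (cyc_leaf x) -> connect arc w (cyc_leaf y) ->
  connect arc w (cyc_inner x) /\ connect arc w (cyc_inner y).
Proof.
suff H x' y' : x' != y' -> connect arc w (cyc_leaf x') -> connect arc w (cyc_leaf y') ->
    connect arc w (cyc_inner x').
  by move=> nxy wx wy; split; [exact: H wy | apply: H wx; rewrite // eq_sym].
move=> nxy wx wy; case/connect_last_step: wx => [ewx|[p wp px]].
  rewrite ewx in wy; have /cyc_leaf_inj exy := leaf_connect (cyc_leaf_leaf x') wy.
  by rewrite exy eqxx in nxy.
have nm : cyc_leaf x' != m :> nat by rewrite cyc_leaf_val; lia.
by rewrite (cyc_parent k_gt0 l_gt0 nm px (cyc_leaf_arc x')).
Qed.

Lemma cyc_lca x y z : x != y ->
  connect arc z (cyc_inner x) -> connect arc z (cyc_inner y) ->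
  (forall w, connect arc w (cyc_inner x) -> connect arc w (cyc_inner y) -> connect arc w z) ->
  (exists u, is_lca arc (cyc_leaf x) (cyc_leaf y) u /\ cyc_lab u = l1) <-> cyc_lab z = l1.
Proof.
move=> nxy zx zy H; apply: lca_greatest (cyc_acyclic k_gt0 l_gt0) _ _ _.
- exact: connect_trans zx (connect1 (cyc_leaf_arc x)).
- exact: connect_trans zy (connect1 (cyc_leaf_arc y)).
by move=> w wx wy; have [] := cyc_common_anc nxy wx wy; apply: H.
Qed.

Lemma cyc_inner_lab x : cyc_lab (cyc_inner x) = lab_of (adj x v).
Proof.
by rewrite /cyc_lab cyc_innerE /= nth_indexv ltnS index_le.
Qed.

Lemma polar_network : level1_explainable adj.
Proof.
exists m.*2.+1, arc, cyc_lab, cyc_leaf.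
split; [exact: cyc_network | exact: cyc_level1 | |].
  move=> i; rewrite cyc_leafE // /cyc_lab.
  case: eqP => [->|_]; first by split; [case: b|].
  by case: leqP => //= _; case: (adj _ _).
have cov := cp_cover pp.
split=> [x y _ _|w|x y _ _ nxy]; first exact: cyc_leaf_inj.
  split=> [lw|[x _ <-]]; last exact: cyc_leaf_leaf.
  rewrite cyc_leafE // in lw; have ltw := ltn_ord w.
  have [i ei] : exists i, w = m + i.+1 :> nat by exists (w - m.+1); lia.
  exists (nth v (xs ++ ys) i); first by rewrite inE.
  apply: ord_inj; rewrite cyc_leaf_val ei; congr (_ + _.+1).
  have [lti|lei] := ltnP i (size (xs ++ ys)).
    by rewrite index_uniq //; have /andP[] := cp_uniq pp.
  rewrite nth_default // memNindex //; move: lei; rewrite size_cat; lia.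
wlog lt_xy : x y nxy / index x (xs ++ ys) < index y (xs ++ ys).
  move=> H; case: (ltngtP (index x (xs ++ ys)) (index y (xs ++ ys))) => [|lt|e]; first exact: H.
    rewrite adj_sym; rewrite eq_sym in nxy; apply: iff_trans (H y x nxy lt) _.
    by split=> -[z [lz tz]]; exists z; split=> //; apply: is_lca_sym.
  by case/eqP: nxy; rewrite -(nth_indexv x) -(nth_indexv y) e.
have same : connect arc (cyc_inner x) (cyc_inner y) -> adj x y = adj x v ->
    adj x y <-> exists z, is_lca arc (cyc_leaf x) (cyc_leaf y) z /\ cyc_lab z = l1.
  move=> xy ->; apply: iff_sym; apply: iff_trans (cyc_lca nxy (connect0 _ _) xy _) _ => //.
  by rewrite cyc_inner_lab lab_ofE.
have le_y := index_le y.
have dom s : pairwise (fun x y => adj x y == adj x v) s -> x \in s -> y \in s ->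
    index x s < index y s -> adj x y = adj x v.
  move=> /(pairwiseP v) ds xins yins lts.
  have := ds (index x s) (index y s); rewrite !inE !index_mem => /(_ xins yins lts).
  by rewrite !nth_index // => /eqP.
(* The leaf of [v] hangs from the hybrid, which is below every other cycle vertex. *)
have [ey|nyv] := eqVneq y v.
  apply: same; last by rewrite ey.
  apply: cyc_to_hybrid; rewrite ?cyc_innerE //; first lia.
  by rewrite ey memNindex // size_cat.
have := cov x; have := cov y; rewrite !inE !mem_cat (negbTE nyv) /=.
have ix z : z \in xs -> index z (xs ++ ys) = index z xs by move=> zx; rewrite index_cat zx.
have dis z : z \in ys -> z \notin xs.
  have := cp_uniq pp; rewrite cons_uniq cat_uniq => /and4P[_ _ /hasPn H _]; exact: H.
have iy z : z \in ys -> index z (xs ++ ys) = k + index z ys.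
  by move=> zy; rewrite index_cat (negbTE (dis z zy)).
have xk z : z \in xs -> index z (xs ++ ys) < k by move=> zx; rewrite ix // index_mem.
have yk z : z \in ys -> k <= index z (xs ++ ys) < k + l.
  by move=> zy; rewrite iy // leq_addr ltn_add2l index_mem.
move=> yxy /or3P[/eqP exv|xxs|xys].
- by move: lt_xy; rewrite exv memNindex // size_cat ltnNge le_y.
- case/orP: yxy => [yxs|yys].
    apply: same; last by apply: (dom _ (cp_left pp)) => //; rewrite -!ix.
    have := xk y yxs.
    by move=> lty; apply: cyc_chain_left; rewrite ?cyc_innerE; lia.
  (* On opposite chains the root is the only common ancestor, and its label encodes [b]. *)
  have -> : adj x y = b by apply/eqP/(allrelP (cp_cross pp)).
  have ky := yk y yys; have kx := xk x xxs.
  apply: iff_sym; apply: iff_trans (cyc_lca (z := ord0) nxy _ _ _) _.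
  + by apply: cyc_root_connect; rewrite // cyc_innerE ltnS (leq_trans kx) ?leq_addr.
  + by apply: cyc_root_connect; rewrite // cyc_innerE ltnS; case/andP: ky.
  + move=> w wx wy; have /andP[ky1 ky2] := ky.
    rewrite (cyc_sides_anc k_gt0 l_gt0 _ _ _ wx wy) //; by rewrite cyc_innerE.
  by rewrite /cyc_lab eqxx lab_ofE.
case/orP: yxy => [yxs|yys].
  have /andP[kx _] := yk x xys.
  by have := leq_ltn_trans (leq_trans (ltnW (xk y yxs)) kx) lt_xy; rewrite ltnn.
apply: same; last by apply: (dom _ (cp_right pp)) => //; move: lt_xy; rewrite !iy // ltn_add2l.
have := yk x xys => kx.
by apply: cyc_chain_right; rewrite ?cyc_innerE; lia.
Qed.

End PolarNetwork.

(** * Reading the order off a caterpillar *)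

Lemma lab_eq (a b : lab) : a <> lodot -> b <> lodot -> (a = l1 <-> b = l1) -> a = b.
Proof. by case: a b => -[] // _ _ [h1 h2]; [have := h2 erefl | have := h1 erefl]. Qed.

Section CaterpillarOrder.
Variables (T : finType) (adj : rel T) (W : finType) (arc : rel W).
Variables (A : {set T}) (t : W -> lab) (f : T -> W) (v : T).
Hypotheses (tree : is_tree arc) (labt : labeling arc t) (dis : discriminating arc t).
Hypotheses (expl : explains_on adj arc A t f) (vA : v \in A).
Hypothesis outdeg_inner : forall w, ~~ leaf arc w -> outdeg arc w = 2.
Local Notation anc := (connect arc).
Let net : is_network arc := tree.1.
Let acy : acyclic arc := network_acyclic net.

Variables (r : W) (s : seq W).
Hypotheses (r_root : indeg arc r = 0) (s_uniq : uniq (r :: s)).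
Hypothesis s_inner : forall w, (w \in r :: s) = ~~ leaf arc w.
Hypothesis s_und : forall i j, i < size (r :: s) -> j < size (r :: s) ->
  und arc (nth r (r :: s) i) (nth r (r :: s) j) = (i.+1 == j) || (j.+1 == i).

Variables (p y : W).
Hypotheses (y_neq : y != f v) (y_leaf : leaf arc y) (pv : arc p (f v)) (py : arc p y).

Let unique_parent u u' w : arc u w -> arc u' w -> u = u'.
Proof. by apply: indeg1_unique; case: tree. Qed.

Let sp i := nth r (r :: s) i.

Let sp_inj i j : i < size (r :: s) -> j < size (r :: s) -> sp i = sp j -> i = j.
Proof. by move=> li lj /eqP; rewrite nth_uniq // => /eqP. Qed.

Let sp_last i : i < size (r :: s) -> size (r :: s) <= i.+1 -> sp i = last r s.
Proof. by rewrite (last_nth r) /sp => li ge; congr nth; rewrite /= in li ge; lia. Qed.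

Let arc_root u : ~~ arc u r.
Proof.
apply/negP=> ur; move/eqP: r_root; rewrite cards_eq0 => /eqP/setP/(_ u).
by rewrite !inE ur.
Qed.

(* The root end fixes the orientation, since no vertex has two parents. *)
Let spine_arc i : i.+1 < size (r :: s) -> arc (sp i) (sp i.+1).
Proof.
elim: i => [|i IH] li.
  have /orP[//|] : und arc (sp 0) (sp 1) by rewrite s_und ?eqxx.
  by rewrite (negbTE (arc_root _)).
have /orP[//|back] : und arc (sp i.+1) (sp i.+2) by rewrite s_und ?eqxx // ltnW.
have /sp_inj := unique_parent (IH (ltnW li)) back.
by move=> /(_ (ltnW (ltnW li)) li)/eqP; rewrite ltn_eqF.
Qed.

Let spine_path : path arc r s.
Proof. by apply/(pathP r) => i li; apply: (spine_arc (i := i)). Qed.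

Let spine_next i j : i < size (r :: s) -> j < size (r :: s) ->
  arc (sp i) (sp j) -> j = i.+1.
Proof.
move=> li lj ij; have : und arc (sp i) (sp j) by rewrite /und ij.
rewrite s_und // => /orP[/eqP//|/eqP ji].
rewrite -ji in ij li *; case: (acyclic_arcF acy ij (connect1 (spine_arc li))).
Qed.

Let inner_sp w : ~~ leaf arc w -> exists2 i, i < size (r :: s) & w = sp i.
Proof.
by rewrite -s_inner => ws; exists (index w (r :: s)); rewrite ?index_mem // /sp nth_index.
Qed.

Let sp_inner i : i < size (r :: s) -> ~~ leaf arc (sp i).
Proof. by move=> li; rewrite -s_inner mem_nth. Qed.

Let arc_inner u w : arc u w -> ~~ leaf arc u.
Proof. by move=> uw; apply/negP=> /leaf_arcF/(_ uw). Qed.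

Let fv_leaf : leaf arc (f v) := explains_leaf expl vA.

(** Any earlier spine vertex has an inner child, whereas both children of [p] are leaves. *)
Let cherry_last : p = last r s.
Proof.
have [i li ep] := inner_sp (arc_inner pv).
have [lt|ge] := ltnP i.+1 (size (r :: s)).
  have a := spine_arc lt; rewrite -ep in a.
  have nl := sp_inner lt; have := outdeg2 (outdeg_inner (arc_inner pv)) y_neq py pv a.
  by case/orP=> /eqP e; rewrite e ?y_leaf ?fv_leaf in nl.
by rewrite ep sp_last.
Qed.

Let leaf_f w : leaf arc w -> exists2 x, x \in A & f x = w.
Proof. by case: expl => _ lf _ /lf. Qed.

(** The last spine vertex has the cherry mate [y]. Any other has a second child besides its spine
    successor; this is a leaf, and it is not [f v], whose parent is the last spine vertex. *)
Let pendant w : w \in r :: s -> exists x, [/\ x \in A, x != v & arc w (f x)].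
Proof.
rewrite s_inner => nlw; have [i li ew] := inner_sp nlw.
have [lt|ge] := ltnP i.+1 (size (r :: s)); last first.
  have -> : w = p by rewrite cherry_last ew sp_last.
  have [x xA ex] := leaf_f y_leaf; exists x; rewrite xA ex; split=> //.
  by apply: contraNneq y_neq => exv; rewrite -ex exv.
have [c wc nc] : exists2 c, arc w c & c != sp i.+1.
  have [c [c' [ncc wc wc']]] := outdeg_ge2 (eq_leq (esym (outdeg_inner nlw))).
  have [ec|] := eqVneq c (sp i.+1); last by exists c.
  by exists c'; rewrite // -ec eq_sym.
have lc : leaf arc c.
  apply/negPn/negP=> /inner_sp[j lj ec]; rewrite ew ec in wc.
  by move: nc; rewrite ec (spine_next li lj wc) eqxx.
have [x xA ex] := leaf_f lc; exists x; rewrite xA ex; split=> //.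
apply/eqP=> exv; rewrite -ex exv in wc.
have := unique_parent wc pv; rewrite cherry_last (last_nth r) ew => /(sp_inj li).
by move=> /(_ (ltnSn _)) ei; move: lt; rewrite ei ltnn.
Qed.

Let lf w : T := odflt v [pick x | [&& x \in A, x != v & arc w (f x)]].

Let lfP w : w \in r :: s -> [/\ lf w \in A, lf w != v & arc w (f (lf w))].
Proof.
move=> /pendant[x [xA nxv wx]]; rewrite /lf; case: pickP => [z /and3P[]//|/(_ x)].
by rewrite xA nxv wx.
Qed.

Let lf_inj : {in r :: s &, injective lf}.
Proof.
move=> w w' /lfP[_ _ a] /lfP[_ _ a'] e; rewrite e in a; exact: unique_parent a a'.
Qed.

Let f_inj : {in A &, injective f}. Proof. by case: expl. Qed.

Let leaf_parent x : x \in A -> exists w, arc w (f x).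
Proof.
move=> xA; have lx := explains_leaf expl xA; have [r0 rr] := network_root net.
case/connect_last_step: (rr (f x)) => [e|[w _ wx]]; last by exists w.
have := rr r; rewrite e => /(leaf_connect lx) er.
by have := s_inner r; rewrite mem_head -er lx.
Qed.

(** The parent of a leaf is on the spine and has just two children, one of which is the next spine
    vertex or, at the bottom, [f v]. The other one is the chosen leaf. *)
Let spine_cover : A =i v :: map lf (r :: s).
Proof.
move=> x; apply/idP/idP=> [xA|]; last first.
  by rewrite inE => /orP[/eqP->//|/mapP[w /lfP[lA _ _] ->]].
rewrite in_cons; have [//|nxv] := eqVneq x v; have [w wx] := leaf_parent xA.
have nlw := arc_inner wx; have ws : w \in r :: s by rewrite s_inner.
have [lA nlv wl] := lfP ws.
have inner_child c : arc w c -> c != f (lf w) -> c != f x -> lf w = x.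
  move=> wc n1 n2; apply/eqP/negPn/negP=> nlx.
  have nf : f (lf w) != f x by apply: contraNneq nlx => /f_inj->.
  by have := outdeg2 (outdeg_inner nlw) nf wl wx wc; rewrite (negbTE n1) (negbTE n2).
have nefx z z' : z \in A -> z' \in A -> z != z' -> f z != f z'.
  by move=> zA z'A; apply: contraNneq => /f_inj->.
suff e : lf w = x by apply/orP; right; apply/mapP; exists w.
have [i li ew] := inner_sp nlw.
have [lt|ge] := ltnP i.+1 (size (r :: s)).
  have nl := sp_inner lt.
  apply: (inner_child (sp i.+1)); first by rewrite ew; apply: spine_arc.
    by apply: contraNneq nl => ->; exact: (explains_leaf expl lA).
  by apply: contraNneq nl => ->; exact: (explains_leaf expl xA).
have ewp : w = p by rewrite cherry_last ew sp_last.
by apply: (inner_child (f v)); [rewrite ewp | apply: nefx; rewrite // eq_sym ..].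
Qed.

Let adj_below w u : w \in r :: s -> u \in A -> u != lf w -> anc w (f u) ->
  adj (lf w) u <-> t w = l1.
Proof.
move=> ws uA nul wu; have [lA _ wl] := lfP ws; have [_ _ ex] := expl.
apply: iff_trans (ex _ _ lA uA _) _; first by rewrite eq_sym.
apply: lca_greatest acy (connect1 wl) wu _ => z zl zu.
case/connect_last_step: zl => [e|[q zq ql]]; last by rewrite (unique_parent wl ql).
rewrite e in zu; have /f_inj := leaf_connect (explains_leaf expl lA) zu.
by move=> /(_ lA uA) e'; rewrite e' eqxx in nul.
Qed.

Let adj_apex w : w \in r :: s -> adj (lf w) v <-> t w = l1.
Proof.
move=> ws; have [_ nlv _] := lfP ws; apply: adj_below => //; first by rewrite eq_sym.
apply: connect_trans (path_connect_last spine_path ws) _.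
by rewrite -cherry_last; apply: connect1.
Qed.

Lemma spine_order : caterpillar_order adj A v (map lf (r :: s)).
Proof.
split=> //.
- rewrite cons_uniq map_inj_in_uniq // s_uniq andbT.
  by apply/mapP=> -[w /lfP[_ + _] ev]; rewrite -ev eqxx.
- rewrite pairwise_map.
  have : pairwise [rel x y | anc x y && (x != y)] (r :: s).
    rewrite pairwise_relI -uniq_pairwise s_uniq andbT.
    rewrite -sorted_pairwise; last exact: connect_trans.
    by apply: sub_path spine_path => u w; apply: connect1.
  apply: (sub_in_pairwise (P := mem (r :: s))); last by apply/allP.
  move=> w w' ws ws' /= /andP[ww' nww']; have [lA' _ wl'] := lfP ws'.
  have e1 := adj_below ws lA' _ (connect_trans ww' (connect1 wl')).
  have {}e1 : adj (lf w) (lf w') <-> t w = l1.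
    by apply: e1; apply: contraNneq nww' => /lf_inj ->.
  have e2 := adj_apex ws.
  by apply/eqP; apply/idP/idP => [/e1/e2|/e2/e1].
(* The label of a spine vertex is recovered from the adjacency of its leaf to [v], so the
   discriminating condition becomes alternation. *)
rewrite -map_comp sorted_map.
apply: (sub_in_path (P := mem (r :: s)) _ _ spine_path); last by apply/allP.
move=> w w' ws ws' ww' /=; apply/eqP=> e.
have [nl nl'] : ~~ leaf arc w /\ ~~ leaf arc w' by rewrite -!s_inner.
have neq_odot u : ~~ leaf arc u -> t u <> lodot by move=> /negP nu /labt.
apply: (dis ww' nl nl'); apply: lab_eq; try exact: neq_odot.
apply: iff_trans (iff_sym (adj_apex ws)) _; rewrite -(adj_apex ws').
by move: e => /= ->.
Qed.

End CaterpillarOrder.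

Lemma caterpillar_cherry_order (T : finType) (adj : rel T) (A : {set T}) (v : T) :
  v \in A -> caterpillar_cherry adj A v -> exists xs, caterpillar_order adj A v xs.
Proof.
move=> vA [n [arc [t [f [[tree labt dis [out2 [r [s [r0 us sin sund]]]]]]]]]].
case=> expl [p [y [ny _ ly pv py]]].
by eexists; apply: (spine_order tree labt dis expl vA out2 r0 us sin sund ny ly pv py).
Qed.

(** * Polar-cats correspond to polar pairs *)

Section PolarCat.
Variables (T : finType) (adj : rel T).
Hypotheses (adj_irr : irreflexive adj) (adj_sym : symmetric adj).
Implicit Types (v : T) (A B : {set T}) (b : bool).

(** By [order_connected] the first type records connectedness of the part, so it is opposite to
    [b]. *)
Lemma order_alternating A v xs b :
  caterpillar_order adj A v xs -> (b <-> ~ connected_in adj A) ->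
  alternating b [seq adj x v | x <- xs].
Proof.
case: xs => [|x s] co ce; first by have := co_neq co.
have cx := order_connected adj_irr adj_sym co.
rewrite /alternating /=; have /= -> := co_alt co; rewrite andbT.
by case: (b) ce (adj x v) cx => -[h1 h2] [] [h3 h4] //; [case: (h1 isT (h4 isT)) | apply: h2 => /h3].
Qed.

Lemma polar_cat_polar_pair v A B :
  polar_cat_at adj v A B -> exists xs ys b, polar_pair adj v xs ys b.
Proof.
case=> -[[eU eI _ _] _] [_ [con [cA cB]]].
have [vA vB] : v \in A /\ v \in B.
  by apply/andP; rewrite -in_setI eI inE.
have [xs coA] := caterpillar_cherry_order vA cA.
have [ys coB] := caterpillar_cherry_order vB cB.
have eA := co_mem coA; have eB := co_mem coB.
have inA x : x \in xs -> x \in A :\ v.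
  move=> xx; rewrite !inE eA inE xx orbT andbT.
  by apply: contraTneq xx => ->; have /andP[] := co_uniq coA.
have inB x : x \in ys -> x \in B :\ v.
  move=> xx; rewrite !inE eB inE xx orbT andbT.
  by apply: contraTneq xx => ->; have /andP[] := co_uniq coB.
(* [b] is true for the join of disconnected parts and false for the union of connected ones. *)
have [b [bA bB cr]] : exists b, [/\ b <-> ~ connected_in adj A, b <-> ~ connected_in adj B &
    forall x y, x \in A :\ v -> y \in B :\ v -> adj x y = b].
  case: con => [[kA [kB un]]|[nA [nB jo]]].
    exists false; split; [by split | by split|].
    by move=> x y xA yB; apply/negbTE/un.
  by exists true; split=> // x y xA yB; apply: jo.
exists xs, ys, b; split; [split| | | |].
- have := co_uniq coA; rewrite cons_uniq => /andP[vx ux].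
  have := co_uniq coB; rewrite cons_uniq => /andP[vy uy].
  rewrite cons_uniq mem_cat negb_or vx vy cat_uniq ux uy /= andbT.
  apply/hasPn=> x /inB; rewrite !inE => /andP[nxv xB]; apply/negP=> /= /inA.
  rewrite !inE => /andP[_ xA]; have : x \in A :&: B by rewrite inE xA.
  by rewrite eI inE (negbTE nxv).
- move=> x; have : x \in A :|: B by rewrite eU inE.
  by rewrite !inE mem_cat eA eB !inE => /orP[/orP[]|/orP[]] ->; rewrite ?orbT.
- exact: co_dom coA.
- exact: co_dom coB.
- by apply/allrelP=> x y /inA xA /inB yB; rewrite cr.
- exact: co_neq coA.
- exact: co_neq coB.
- exact: order_alternating coA bA.
exact: order_alternating coB bB.
Qed.

Lemma polar_pair_order v xs ys b :
  polar_pair adj v xs ys b ->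
  caterpillar_order adj [set x in v :: xs] v xs /\
  (connected_in adj [set x in v :: xs] <-> ~~ b).
Proof.
move=> pp; have co : caterpillar_order adj [set x in v :: xs] v xs.
  split; last 1 first.
  - exact: path_sorted (pp_left pp).
  - by have := cp_uniq pp; rewrite -cat_cons cat_uniq => /andP[].
  - by move=> x; rewrite inE.
  - exact: pp_left_neq pp.
  - exact: cp_left pp.
split=> //; case: xs pp co => [|x s] pp co; first by have := pp_left_neq pp.
apply: iff_trans (order_connected adj_irr adj_sym co) _.
by have /= /andP[+ _] := pp_left pp; case: b {pp}; case: (adj x v).
Qed.

Lemma polar_pair_polar_cat v xs ys b :
  4 <= #|T| -> polar_pair adj v xs ys b -> polar_cat adj.
Proof.
move=> T4 pp; have pp' := polar_pair_sym adj_sym pp.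
have [coA kA] := polar_pair_order pp; have [coB kB] := polar_pair_order pp'.
exists v, [set x in v :: xs], [set x in v :: ys].
have card2 zs : zs != [::] -> uniq (v :: zs) -> 1 < #|[set x in v :: zs]|.
  move=> nz /card_uniqP e; rewrite cardsE e; by case: zs nz {e}.
have cr x y : x \in [set x in v :: xs] :\ v -> y \in [set x in v :: ys] :\ v -> adj x y = b.
  rewrite !inE => /andP[/negbTE-> /= xx] /andP[/negbTE-> /= yy].
  by apply/eqP/(allrelP (cp_cross pp)).
split; [split; [split|split; [|split]]|split=> //; split; [|split]].
- apply/setP=> x; rewrite !inE; have := cp_cover pp x; rewrite inE mem_cat.
  by case: (x == v); case: (x \in xs); case: (x \in ys).
- apply/setP=> x; rewrite !inE; case: eqP => //= _; apply/negP=> /andP[xx xy].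
  have := cp_uniq pp; rewrite cons_uniq cat_uniq => /and4P[_ _ /hasPn/(_ x xy)/negP[]//].
- exact: card2 (pp_left_neq pp) (co_uniq coA).
- exact: card2 (pp_right_neq pp) (co_uniq coB).
- exact: (order_cograph adj_sym coA).
- exact: (order_cograph adj_sym coB).
- by case: b {pp pp' kA kB} cr => cr; [left|right] => x y xA yB; rewrite cr.
- case: b {pp pp'} kA kB cr => kA kB cr; [right|left].
    by split; [move/kA|split; [move/kB|move=> x y xA yB; rewrite cr]].
  by split; [apply/kA|split; [apply/kB|move=> x y xA yB; rewrite cr]].
- exact: order_caterpillar coA.
exact: order_caterpillar coB.
Qed.

End PolarCat.

Theorem mainTheorem3 (T : finType) (adj : rel T) :
  irreflexive adj -> symmetric adj ->
  (polar_cat adj <-> primitive adj /\ level1_explainable adj).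
Proof.
move=> adj_irr adj_sym; split=> [[v [A [B pc]]]|[prim [n [arc [t [f [net lev _ expl]]]]]]].
  have T4 : 4 <= #|T| by case: pc => _ [].
  have [xs [ys [b pp]]] := polar_cat_polar_pair adj_irr adj_sym pc.
  by split; [apply: polar_pair_primitive pp | apply: polar_network pp].
have [d hd] := hybrid_exists prim net expl.
have [a [ps [qs hc]]] := hybrid_cycle_exists net hd.
have [v [xs [ys [b cp]]]] := cycle_caterpillar_pair prim net lev expl hc hd.
apply: (polar_pair_polar_cat adj_irr adj_sym prim.1).
exact: primitive_polar_pair cp.
Qed.
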